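(* Fix $\epsilon\in(0,1)$ and $\alpha>0$. There are constants $0<c\le C<+\infty$, depending only on $\epsilon$ and $\alpha$, such that for every straight line $L$ through the origin in $\mathbb R^2$, every real $A>0$ and every integer $N\ge2$ with $N\in[\epsilon A,A/\epsilon]$, the spectral gap $\lambda$ of the Metropolis chain for the probability measure $\pi=Z_NF_N$ on $\mathcal B_N=\{-N+1,\dots,N\}^2$ given by $$F_N(x_1,x_2)=\left[1+A\,d_2\left(\left(\tfrac{x_1-1/2}{N},\tfrac{x_2-1/2}{N}\right),L\right)\right]^\alpha,\qquad Z_N^{-1}=\sum_{\mathcal B_N}F_N,$$ satisfies $c\,\rho_N\le\lambda\le C\rho_N$, where $$\rho_N=\begin{cases}\dfrac1{N^2}&\text{if }\alpha<1,\\[1ex] \dfrac{1}{N^2\log N}&\text{if }\alpha=1,\\[1ex] \dfrac{1}{N^{\alpha+1}}&\text{if }\alpha>1.\end{cases}$$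
   Context: $d_2(x,L)$ denotes the Euclidean distance from the point $x\in[-1,1]^2$ to the line $L$. The Metropolis chain for $\pi$ on $\mathcal B_N$ (with proposal the simple random walk on the grid with holding at the boundary) is the Markov kernel $M$ on $\mathcal B_N$ given by $M(\mathbf k,\mathbf l)=\frac14\min\{1,\pi(\mathbf l)/\pi(\mathbf k)\}$ if $|k_1-l_1|+|k_2-l_2|=1$, $M(\mathbf k,\mathbf l)=0$ if $|k_1-l_1|+|k_2-l_2|>1$, and $M(\mathbf k,\mathbf k)=1-\sum_{\mathbf l\ne\mathbf k}M(\mathbf k,\mathbf l)$. It is reversible with respect to $\pi$. The spectral gap is $\lambda=1-\beta_1$, where $\beta_1$ is the second largest eigenvalue of $M$ acting on $L^2(\mathcal B_N,\pi)$. *)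

(* Defs.v *)
From HB Require Import structures.
From mathcomp Require Import all_boot all_order all_algebra.
From mathcomp Require Import all_classical all_reals all_analysis.

Set Implicit Arguments.
Unset Strict Implicit.
Unset Printing Implicit Defensive.

Import Order.TTheory GRing.Theory Num.Theory.
Local Open Scope ring_scope.

Section SpectralGap.
Variables (R : realType) (T : finType).
Implicit Type M : T -> T -> R.

(* For a fully supported probability measure on T, the space L^2 is the space
   of all real functions on T; the inner product plays no role in the
   definition of the eigenvalues. *)
Definition kernel_fun M (f : {ffun T -> R^o}) : {ffun T -> R^o} :=
  [ffun k => \sum_l M k l * f l].

Fact kernel_fun_is_linear M : linear (kernel_fun M).
Proof.
move=> a f g; apply/ffunP => k; rewrite !ffunE scaler_sumr -big_split /=.
by apply: eq_bigr => l _; rewrite !ffunE mulrDr scalerAr.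
Qed.

HB.instance Definition _ M :=
  GRing.isLinear.Build R {ffun T -> R^o} {ffun T -> R^o} _
    (kernel_fun M) (kernel_fun_is_linear M).

Definition kernel_op M : 'End({ffun T -> R^o}) := linfun (kernel_fun M).

End SpectralGap.

(* For an operator that is self-adjoint for some inner product, such as a
   reversible kernel, geometric and algebraic multiplicities agree and all the
   eigenvalues are real; entry 0 is then the largest eigenvalue. *)
Definition is_eigenvalue_seq (R : realType) (V : vectType R) (f : 'End(V))
    (s : seq R) : Prop :=
  sorted >=%R s /\ forall a : R, count_mem a s = \dim (passmx.leigenspace f a).

Definition eigenvalue_seq (R : realType) (V : vectType R) (f : 'End(V)) :
    seq R :=
  xget [::] [set s | is_eigenvalue_seq f s]%classic.

Lemma is_eigenvalue_seq_uniq (R : realType) (V : vectType R) (f : 'End(V))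
    (s t : seq R) : is_eigenvalue_seq f s -> is_eigenvalue_seq f t -> s = t.
Proof.
move=> [ss cs] [st ct]; apply: (sorted_eq _ _ ss st).
- exact: ge_trans.
- exact: ge_anti.
- by apply/allP => a _ /=; rewrite cs ct.
Qed.

Lemma eigenvalue_seqP (R : realType) (V : vectType R) (f : 'End(V)) :
  is_eigenvalue_seq f (eigenvalue_seq f).
Proof.
apply: (@xgetPex _ [::] [set s | is_eigenvalue_seq f s]%classic).
pose e := vbasis {:V}.
pose p := char_poly (passmx.mxof e e f).
have p0 : p != 0 by rewrite monic_neq0 ?char_poly_monic.
have be : basis_of {:V} e by apply: vbasisP.
have rp a : passmx.leigenvalue f a -> root p a.
  move=> la; rewrite -eigenvalue_root_char; apply: contraNneq la.
  by rewrite (passmx.leigenspaceE be) => ->; rewrite passmx.vsof0.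
have [s us sP] : exists2 s : seq R, uniq s &
    forall a, (a \in s) = passmx.leigenvalue f a.
  pose P n := `[< exists2 s : seq R, uniq s /\ all (passmx.leigenvalue f) s & size s = n >].
  have P0 : exists n, P n by exists 0%N; apply/asboolP; exists [::].
  have Pb n : P n -> (n <= size p)%N.
    move=> /asboolP [s [us /allP ls] <-]; apply/ltnW/max_poly_roots => //.
    by apply/allP => a /ls /rp.
  case: (ex_maxnP P0 Pb) => n /asboolP [s [us ls] sn] mx.
  exists s => // a; apply/idP/idP => [|la]; first exact: (allP ls).
  apply/negPn/negP => nas; suff: (n.+1 <= n)%N by rewrite ltnn.
  by apply: mx; apply/asboolP; exists (a :: s); rewrite /= ?nas ?la ?sn.
pose d a := \dim (passmx.leigenspace f a).
exists (sort >=%R (flatten [seq nseq (d a) a | a <- s])); split.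
  by apply: sort_sorted => x y; apply: le_total.
move=> a; rewrite count_sort -/(d a).
rewrite count_flatten -map_comp sumnE big_map.
under eq_bigr do rewrite /= count_nseq.
case: (boolP (a \in s)) => [as_|nas].
  rewrite (bigD1_seq a) //= eqxx mul1n big1 ?addn0 // => b ba.
  by rewrite (negPf ba).
rewrite big_seq big1 => [|b bs].
  by move: nas; rewrite sP negbK /d => /eqP ->; rewrite dimv0.
rewrite /= (_ : (b == a) = false) //.
by apply: contraNF nas => /eqP <-.
Qed.

Definition second_largest_eigenvalue (R : realType) (V : vectType R)
  (f : 'End(V)) : R := (eigenvalue_seq f)`_1.

Definition spectral_gap (R : realType) (T : finType) (M : T -> T -> R) : R :=
  1 - second_largest_eigenvalue (kernel_op M).

Section Plane.
Variable R : realType.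

Definition euclid_dist (x y : R * R) : R :=
  Num.sqrt ((x.1 - y.1) ^+ 2 + (x.2 - y.2) ^+ 2).

(* The library's norm on R * R is the maximum norm, hence the explicit
   Euclidean distance. *)
Definition d2 (x : R * R) (L : set (R * R)) : R :=
  inf [set euclid_dist x y | y in L]%classic.

Definition line_through_origin (L : set (R * R)) : Prop :=
  exists2 v : R * R, v != (0, 0)
    & L = [set (t * v.1, t * v.2) | t in [set: R]]%classic.

End Plane.

Definition grid (N : nat) : finType := ('I_N.*2 * 'I_N.*2)%type.

(* The index i < 2N stands for the integer i - N + 1 in {-N+1, ..., N}. *)
Definition coord (N : nat) (i : 'I_N.*2) : int := i%:Z - N%:Z + 1.

Definition grid_dist (N : nat) (k l : grid N) : nat :=
  (`|coord k.1 - coord l.1| + `|coord k.2 - coord l.2|)%N.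

Section Metropolis.
Variables (R : realType) (N : nat) (p : grid N -> R).

Definition metropolis_move (k l : grid N) : R :=
  if grid_dist k l == 1%N then 4^-1 * Num.min 1 (p l / p k) else 0.

Definition metropolis (k l : grid N) : R :=
  if k == l then 1 - \sum_(l' | l' != k) metropolis_move k l'
  else metropolis_move k l.

End Metropolis.

Section Target.
Variables (R : realType) (alpha A : R) (L : set (R * R)) (N : nat).

Definition grid_point (k : grid N) : R * R :=
  (((coord k.1)%:~R - 2^-1) / N%:R, ((coord k.2)%:~R - 2^-1) / N%:R).

Definition F_N (k : grid N) : R :=
  (1 + A * d2 (grid_point k) L) `^ alpha.

Definition Z_N : R := (\sum_k F_N k)^-1.

Definition pi_N (k : grid N) : R := Z_N * F_N k.

End Target.

Definition rho (R : realType) (alpha : R) (N : nat) : R :=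
  if alpha < 1 then (N%:R ^+ 2)^-1
  else if alpha == 1 then (N%:R ^+ 2 * ln N%:R)^-1
  else (N%:R `^ (alpha + 1))^-1.

(* Main.v *)
(* Up to normalization, pi is the weight (1 + |t|)^alpha, where t is an affine form
   on the grid whose increments along the axes are bounded by 1/eps, one of them
   being at least eps/2. Let G = sum_(1 <= m <= 2N) m^(-alpha), so that
   N^(alpha+1) G is of order 1/rho_N.

   Lower bound: join k to l by the row of k followed by the column of l. On each
   row or column, |t| grows at least linearly away from its minimum, so the sum of
   the weight times the sum of its inverse is O(N^(alpha+1) G); a weighted
   Cauchy-Schwarz inequality along the two segments turns this into a Poincare
   inequality, whatever the direction of L.

   Upper bound: use phi(t) as a test function, where phi is odd, so that phi(t) has
   mean zero by the central symmetry of the grid: phi(t) = t if alpha < 1,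
   phi(t) = sgn(t) log(1 + |t|) if alpha = 1, and the truncation of t to [-1, 1]
   if alpha > 1. *)

Require Import Defs.
From mathcomp Require Import all_boot all_order all_algebra.
From mathcomp Require Import all_classical all_reals all_analysis.
From mathcomp Require Import ring lra zify.
Import Order.TTheory GRing.Theory Num.Theory.
Import numFieldNormedType.Exports.
Local Open Scope ring_scope.
Set Implicit Arguments.
Unset Strict Implicit.
Unset Printing Implicit Defensive.

(** * Variational characterization of the spectral gap *)

Section EigenvalueOrder.
Variables (R : realType) (s : seq R).
Hypothesis ss : sorted >=%R s.

(** At most one of two distinct values can be the head; the other lies in the tail, all of whose
    entries are at most entry 1. *)
Lemma second_entry_ge (a b m : R) :
  a \in s -> b \in s -> m <= a -> m <= b -> a != b -> m <= s`_1.
Proof.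
case: s ss => [|x [|y t]] //=.
  by rewrite !inE => _ /eqP -> /eqP ->; rewrite eqxx.
case/andP => yx yt.
have ty z : z \in y :: t -> z <= y.
  rewrite inE => /predU1P[->//|zt].
  have /(order_path_min ge_trans)/allP := yt; exact.
rewrite inE => /predU1P[->|/ty ay]; last by move=> _ ma *; exact: le_trans ay.
rewrite inE => /predU1P[->|/ty byy]; first by rewrite eqxx.
by move=> _ mb _; exact: le_trans byy.
Qed.

Lemma second_entry_ge_mult (a : R) : (1 < count_mem a s)%N -> a <= s`_1.
Proof.
case: s ss => [|x [|y t]] //=; first by case: (x == a).
case/andP => yx yt; have [->//|ya] := eqVneq y a.
move=> at1; have : a \in t.
  rewrite -has_pred1 has_count.
  by move: at1; case: (count_mem a t) => //=; case: (x == a).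
by have /(order_path_min ge_trans)/allP := yt; exact.
Qed.

Lemma second_entry_mem : (1 < size s)%N -> s`_1 \in s.
Proof. exact: mem_nth. Qed.

(** A maximal entry 1 must coincide with entry 0. This is how a vanishing gap produces a multiple
    eigenvalue. *)
Lemma second_entry_count : (1 < size s)%N ->
  (forall b, b \in s -> b <= s`_1) -> (1 < count_mem (s`_1)%R s)%N.
Proof.
case: s ss => [|x [|y t]] //= /andP[yx yt] _ bs.
have /bs xy : x \in [:: x, y & t] by rewrite inE eqxx.
have -> : x = y by apply/le_anti/andP.
by rewrite eqxx.
Qed.

End EigenvalueOrder.

Lemma continuous_sumr (R : realType) (U : topologicalType) (I : Type)
    (r : seq I) (F : I -> U -> R) :
  (forall i, continuous (F i)) -> continuous (fun x => \sum_(i <- r) F i x).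
Proof.
move=> Fc; elim: r => [|i r IHr].
  under [X in continuous X]eq_fun do rewrite big_nil.
  exact: cst_continuous.
under [X in continuous X]eq_fun do rewrite big_cons.
by move=> x; apply: continuousD; [exact: Fc|exact: IHr].
Qed.

Section ReversibleKernel.
Variables (R : realType) (T : finType) (w : T -> R) (M : T -> T -> R).
Hypothesis w_gt0 : forall k, 0 < w k.
Hypothesis M_sum1 : forall k, \sum_l M k l = 1.
Hypothesis M_rev : forall k l, w k * M k l = w l * M l k.
Hypothesis M_ge0 : forall k l, k != l -> 0 <= M k l.
Implicit Types f g h : T -> R.

(** Twice the usual Dirichlet form: each unordered pair is counted in both orders, hence the factors
    2 that follow. *)
Definition dirichlet f g :=
  \sum_k \sum_l w k * M k l * ((f k - f l) * (g k - g l)).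
Definition inner f g := \sum_k w k * (f k * g k).

(** By reversibility, exchanging [k] and [l] shows that the part containing [g l] is the opposite of
    the part containing [g k]; row sums equal to 1 identify the latter. *)
Lemma dirichletE f g :
  dirichlet f g = 2 * inner (fun k => f k - \sum_l M k l * f l) g.
Proof.
pose E := \sum_k \sum_l w k * M k l * ((f k - f l) * g k).
have E1 : inner (fun k => f k - \sum_l M k l * f l) g = E.
  apply: eq_bigr => k _.
  rewrite [LHS](_ : _ = w k * g k * \sum_l M k l * (f k - f l)).
    by rewrite mulr_sumr; apply: eq_bigr => l _; ring.
  have -> : \sum_l M k l * (f k - f l) = f k - \sum_l M k l * f l.
    under eq_bigr do rewrite mulrBr.
    by rewrite sumrB -mulr_suml M_sum1 mul1r.
  by ring.
have E2 : \sum_k \sum_l w k * M k l * ((f k - f l) * g l) = - E.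
  rewrite exchange_big /= -sumrN; apply: eq_bigr => k _.
  by rewrite -sumrN; apply: eq_bigr => l _; rewrite M_rev; ring.
rewrite E1 mulr_natl mulr2n -[in X in _ = _ + X](opprK E) -E2 -sumrB.
apply: eq_bigr => k _; rewrite -sumrB; apply: eq_bigr => l _; ring.
Qed.

Lemma dirichletC f g : dirichlet f g = dirichlet g f.
Proof. by apply: eq_bigr => k _; apply: eq_bigr => l _; ring. Qed.

Lemma innerC f g : inner f g = inner g f.
Proof. by apply: eq_bigr => k _; ring. Qed.

Lemma innerDZl f g h c :
  inner (fun k => f k + c * g k) h = inner f h + c * inner g h.
Proof. by rewrite mulr_sumr -big_split; apply: eq_bigr => k _ /=; ring. Qed.

Lemma dirichletDZl f g h c :
  dirichlet (fun k => f k + c * g k) h = dirichlet f h + c * dirichlet g h.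
Proof.
rewrite mulr_sumr -big_split; apply: eq_bigr => k _ /=.
by rewrite mulr_sumr -big_split; apply: eq_bigr => l _ /=; ring.
Qed.

Lemma dirichlet_ge0 f : 0 <= dirichlet f f.
Proof.
apply: sumr_ge0 => k _; apply: sumr_ge0 => l _.
have [->|kl] := eqVneq k l; first by rewrite subrr !mulr0.
by rewrite mulr_ge0 ?sqr_ge0 // mulr_ge0 ?M_ge0 ?ltW.
Qed.

Lemma inner_ge0 f : 0 <= inner f f.
Proof. by apply: sumr_ge0 => k _; rewrite mulr_ge0 ?sqr_ge0 // ltW. Qed.

Lemma inner_gt0 f k : f k != 0 -> 0 < inner f f.
Proof.
move=> fk; rewrite lt_def inner_ge0 andbT; apply: contra fk.
rewrite psumr_eq0 => [/allP /(_ k)|l _]; last first.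
  by rewrite mulr_ge0 ?sqr_ge0 // ltW.
by rewrite mem_index_enum => /(_ isT); rewrite !mulf_eq0 gt_eqF // orbb.
Qed.

Lemma dirichlet_cst f c : dirichlet (fun=> c) f = 0.
Proof.
by apply: big1 => k _; apply: big1 => l _; rewrite subrr mul0r mulr0.
Qed.

(* Compactness of the unit sphere of the mean zero functions. *)
Lemma rayleigh_minimizer f : inner f f != 0 -> inner (fun=> 1) f = 0 ->
  exists2 g, (inner (fun=> 1) g = 0 /\ inner g g = 1) &
    forall h, inner (fun=> 1) h = 0 ->
      dirichlet g g * inner h h <= dirichlet h h.
Proof.
move=> f0 fm.
(* Functions on [T] are transported to row vectors, where compactness and the extreme value theorem
   are available. *)
pose ev (v : 'rV[R]_#|T|) k : R := v ord0 (enum_rank k).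
have ev_cont k : continuous (fun v => ev v k) by exact: coord_continuous.
have cM (a b : 'rV[R]_#|T| -> R) : continuous a -> continuous b ->
    continuous (fun v => a v * b v).
  by move=> ac bc v; exact: (continuousM (ac v) (bc v)).
have cZ (c : R) (b : 'rV[R]_#|T| -> R) : continuous b ->
    continuous (fun v => c * b v).
  by move=> bc; apply: (cM (fun=> c) b _ bc); exact: cst_continuous.
have cD : continuous (fun v => dirichlet (ev v) (ev v)).
  apply: continuous_sumr => k; apply: continuous_sumr => l.
  apply: cZ; have cB : continuous (fun v => ev v k - ev v l).
    by move=> v; apply: continuousB; exact: ev_cont.
  exact: (cM _ _ cB cB).
have cI (F G : 'rV[R]_#|T| -> T -> R) : (forall k, continuous (F^~ k)) ->
    (forall k, continuous (G^~ k)) -> continuous (fun v => inner (F v) (G v)).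
  move=> Fc Gc; apply: continuous_sumr => k.
  by apply: cZ; exact: cM.
pose S := [set v | inner (fun=> 1) (ev v) = 0 /\ inner (ev v) (ev v) = 1]%classic.
have Scl : closed S.
  apply: closedI.
    apply: (closed_comp (f := fun v => inner (fun=> 1) (ev v)) (D := [set 0]%classic)).
      by move=> v _; apply: cI => // k; exact: cst_continuous.
    exact: closed_eq.
  apply: (closed_comp (f := fun v => inner (ev v) (ev v)) (D := [set 1]%classic)).
    by move=> v _; apply: cI.
  exact: closed_eq.
(* On the unit sphere x^2 <= 1/w, so |x| <= 1 + 1/w, a bound that avoids square roots. *)
pose B := [set v : 'rV[R]_#|T| | forall i,
   `[- (1 + (w (enum_val i))^-1), 1 + (w (enum_val i))^-1]%classic (v ord0 i)]%classic.
have Bc : compact B.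
  apply: (@rV_compact _ _ (fun i =>
    `[- (1 + (w (enum_val i))^-1), 1 + (w (enum_val i))^-1]%classic)).
  by move=> i; exact: segment_compact.
have SB : (S `<=` B)%classic.
  move=> v [_ v1] i /=; rewrite in_itv /= -ler_norml.
  set k := enum_val i; set x := v ord0 i.
  have x2 : x ^+ 2 <= (w k)^-1.
    rewrite -[leRHS]mul1r ler_pdivlMr // -v1 /inner (bigD1 k) //=.
    rewrite /ev /k enum_valK -/x mulrC -expr2 lerDl.
    by apply: sumr_ge0 => l _; rewrite mulr_ge0 ?sqr_ge0 // ltW.
  have : x ^+ 2 = `|x| ^+ 2 by rewrite real_normK ?num_real.
  have := normr_ge0 x; have : 0 < (w k)^-1 by rewrite invr_gt0.
  move: x2; move: (w k)^-1 `|x| => a b; nra.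
have Sc : compact S by apply: subclosed_compact Scl Bc SB.
pose mk h c : 'rV[R]_#|T| := \row_i (c * h (enum_val i)).
have evmk h c : ev (mk h c) = (fun k => c * h k).
  by apply/funext => k; rewrite /ev /mk mxE enum_rankK.
have iZ h h' c : inner (fun k => c * h k) h' = c * inner h h'.
  by rewrite /inner mulr_sumr; apply: eq_bigr => k _; ring.
have dZ h h' c : dirichlet (fun k => c * h k) h' = c * dirichlet h h'.
  rewrite /dirichlet mulr_sumr; apply: eq_bigr => k _.
  by rewrite mulr_sumr; apply: eq_bigr => l _; ring.
have Smk h : inner h h != 0 -> inner (fun=> 1) h = 0 ->
    S (mk h (Num.sqrt (inner h h))^-1).
  move=> h0 hm; rewrite /S /= evmk; split.
    by rewrite innerC iZ innerC hm mulr0.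
  rewrite iZ innerC iZ mulrA -invfM -expr2 sqr_sqrtr ?inner_ge0 //.
  by rewrite mulVf.
have S0 : (S !=set0)%classic by exists (mk f (Num.sqrt (inner f f))^-1); exact: Smk.
have [v vS vmin] := EVT_min_rV (f := fun v => dirichlet (ev v) (ev v)) S0 Sc
  (continuous_subspaceT cD).
move: vS; rewrite inE => -[vm v1].
exists (ev v) => // h hm.
have [->|h0] := eqVneq (inner h h) 0; first by rewrite mulr0 dirichlet_ge0.
(* By homogeneity, the minimality on the sphere is applied to [h] divided by its norm. *)
have := vmin _ (mem_set (Smk _ h0 hm)); rewrite evmk dZ dirichletC dZ.
rewrite mulrA -invfM -expr2 sqr_sqrtr ?inner_ge0 // => vh.
have hp : 0 < inner h h by rewrite lt_def h0 inner_ge0.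
by rewrite -ler_pdivlMr // mulrC.
Qed.

(** Lagrange multiplier argument: the residual [r] of the eigenvalue equation is itself orthogonal
    to the constants, hence an admissible direction, and the first variation along it is a multiple
    of its squared norm, which must vanish. *)
Lemma rayleigh_minimizer_eigen g : inner (fun=> 1) g = 0 -> inner g g = 1 ->
  (forall h, inner (fun=> 1) h = 0 ->
     dirichlet g g * inner h h <= dirichlet h h) ->
  forall k, \sum_l M k l * g l = (1 - dirichlet g g / 2) * g k.
Proof.
move=> gm g1 gmin.
pose d := dirichlet g g.
pose r k := g k - \sum_l M k l * g l - d / 2 * g k.
have rE h : dirichlet g h - d * inner g h = 2 * inner r h.
  rewrite dirichletE /inner !mulr_sumr -sumrB; apply: eq_bigr => k _ /=.
  by rewrite /r; field.
have rm : inner (fun=> 1) r = 0.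
  have := rE (fun=> 1); rewrite dirichletC dirichlet_cst innerC gm mulr0 subr0.
  by rewrite innerC => /esym/eqP; rewrite mulf_eq0 pnatr_eq0 => /= /eqP.
(* First variation of the minimisation in the direction r. *)
have var t : 0 <= 2 * t * (2 * inner r r) +
    t ^+ 2 * (dirichlet r r - d * inner r r).
  have := gmin (fun k => g k + t * r k).
  rewrite innerC innerDZl innerC gm innerC rm mulr0 addr0 => /(_ erefl).
  rewrite innerDZl (innerC g) (innerC r) !innerDZl.
  rewrite dirichletDZl (dirichletC g) (dirichletC r) !dirichletDZl.
  rewrite (dirichletC r g) (innerC r g) g1 -/d -(rE r).
  move: (dirichlet r r) (inner r r) (dirichlet g r) (inner g r) => *; nra.
have r0 : inner r r = 0.
  apply/eqP; rewrite eq_le inner_ge0 andbT leNgt; apply/negP => rp.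
  set q := dirichlet r r - d * inner r r in var.
  have q0 : 0 < `|q| + 1 by rewrite ltr_wpDl.
  (* With a = [inner r r], this step is short enough for the negative linear term to dominate the
     quadratic one, whatever the sign of [q]. *)
  have := var (- (inner r r / (`|q| + 1))).
  have := ler_norm q; move: rp q0; move: (inner r r) `|q| => a b a0 b0 qb.
  have -> : 2 * - (a / (b + 1)) * (2 * a) + (- (a / (b + 1))) ^+ 2 * q =
    (a / (b + 1)) ^+ 2 * (q - 4 * (b + 1)) by field; rewrite gt_eqF.
  rewrite leNgt => /negP; apply; rewrite pmulr_rlt0 ?exprn_gt0 ?divr_gt0 //.
  lra.
move=> k; apply/eqP; rewrite -subr_eq0 -oppr_eq0.
have -> : - (\sum_l M k l * g l - (1 - dirichlet g g / 2) * g k) = r k.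
  by rewrite /r /d; ring.
by apply/negPn/negP => /inner_gt0; rewrite r0 ltxx.
Qed.

Lemma mem_leigenspace (a : R) (f : {ffun T -> R^o}) :
  (f \in passmx.leigenspace (kernel_op M) a) = [forall k, \sum_l M k l * f l == a * f k].
Proof.
rewrite memv_ker add_lfunE opp_lfunE scale_lfunE id_lfunE lfunE /= subr_eq0.
apply/eqP/forallP => [fE k|fE].
  by move/ffunP: fE => /(_ k); rewrite !ffunE => ->.
by apply/ffunP => k; rewrite !ffunE; apply/eqP/fE.
Qed.

Let s := eigenvalue_seq (kernel_op M).

Lemma mem_eigenvalue_seqP (a : R) :
  reflect (exists f, (exists k, f k != 0) /\
             forall k, \sum_l M k l * f l = a * f k) (a \in s).
Proof.
have [_ sc] := eigenvalue_seqP (kernel_op M).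
rewrite -has_pred1 has_count sc lt0n dimv_eq0.
apply: (iffP idP) => [|[f [[k fk] fE]]].
  rewrite -subv0 => /subvPn[f]; rewrite mem_leigenspace memv0 => /forallP fE f0.
  exists f; split=> [|k]; last exact/eqP.
  apply/existsP; rewrite -negb_forall; apply: contra f0 => /forallP f0.
  by apply/eqP/ffunP => k; rewrite ffunE; apply/eqP/f0.
apply/negP => /eqP e0.
have : [ffun k => f k : R^o] \in passmx.leigenspace (kernel_op M) a.
  rewrite mem_leigenspace; apply/forallP => l; rewrite ffunE -fE.
  by apply/eqP; apply: eq_bigr => m _; rewrite ffunE.
rewrite e0 memv0 => /eqP/ffunP/(_ k); rewrite !ffunE => /eqP.
by rewrite (negPf fk).
Qed.

Lemma one_mem_eigenvalue_seq (k : T) : 1 \in s.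
Proof.
apply/mem_eigenvalue_seqP; exists (fun=> 1); split; first by exists k; exact: oner_neq0.
by move=> l; under eq_bigr do rewrite mulr1; rewrite M_sum1 mulr1.
Qed.

Lemma eigenvalue_dirichlet a f g : (forall k, \sum_l M k l * f l = a * f k) ->
  dirichlet f g = 2 * (1 - a) * inner f g.
Proof.
move=> fE; rewrite dirichletE -mulrA; congr (_ * _).
by rewrite /inner mulr_sumr; apply: eq_bigr => k _; rewrite fE; ring.
Qed.

(** The minimal Rayleigh quotient d is at most 2 eta, and 1 - d/2 is an eigenvalue. Together with
    the eigenvalue 1 it provides two entries of the sequence that are at least 1 - eta. *)
Lemma spectral_gap_le f eta : 0 <= eta -> inner f f != 0 ->
  inner (fun=> 1) f = 0 -> dirichlet f f <= 2 * eta * inner f f ->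
  spectral_gap M <= eta.
Proof.
move=> eta0 f0 fm fD.
have [g [gm g1] gmin] := rayleigh_minimizer f0 fm.
have gE := rayleigh_minimizer_eigen gm g1 gmin.
have fp : 0 < inner f f by rewrite lt_def f0 inner_ge0.
have : dirichlet g g <= 2 * eta.
  by rewrite -(ler_pM2r fp) (le_trans _ fD) // gmin.
set d := dirichlet g g in gE * => dle.
have [ss sc] := eigenvalue_seqP (kernel_op M).
have [k gk] : exists k, g k != 0.
  have [k gk|g0] := pickP (fun k => g k != 0); first by exists k.
  have i0 : inner g g = 0.
    by apply: big1 => k _; have /negbFE/eqP -> := g0 k; rewrite !mulr0.
  by move/eqP: g1; rewrite i0 eq_sym oner_eq0.
have s1 := one_mem_eigenvalue_seq k.
have sd : 1 - d / 2 \in s by apply/mem_eigenvalue_seqP; exists g; split; [exists k|].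
rewrite /spectral_gap /second_largest_eigenvalue lerBlDr -lerBlDl -/s.
have [d0|d0] := eqVneq (1 - d / 2) 1; last first.
  apply: (second_entry_ge ss sd s1 _ _ d0); first by lra.
  by rewrite gerBl.
apply: le_trans (second_entry_ge_mult ss (a := 1) _); first by rewrite gerBl.
(* When d = 0 both eigenvalues are 1 and multiplicity is needed: were the eigenspace a line, [g]
   would be constant, against mean zero and norm 1. *)
rewrite sc ltnNge; apply/negP => dim1.
pose u : {ffun T -> R^o} := [ffun=> 1].
have uE : u \in passmx.leigenspace (kernel_op M) 1.
  rewrite mem_leigenspace; apply/forallP => l; rewrite ffunE mulr1 -(M_sum1 l).
  by apply/eqP; apply: eq_bigr => m _; rewrite ffunE mulr1.
have u0 : u != 0.
  by apply/eqP => /ffunP/(_ k); rewrite !ffunE => /eqP; rewrite oner_eq0.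
have uS : (<[u]> <= passmx.leigenspace (kernel_op M) 1)%VS by rewrite -memvE.
have /eqP eS : <[u]>%VS == passmx.leigenspace (kernel_op M) 1.
  by rewrite eqEdim uS dim_vline u0.
have : [ffun k => g k : R^o] \in passmx.leigenspace (kernel_op M) 1.
  rewrite mem_leigenspace; apply/forallP => l; rewrite ffunE.
  rewrite -[X in X * _]d0 -gE.
  by apply/eqP; apply: eq_bigr => m _; rewrite ffunE.
rewrite -eS => /vlineP[c /ffunP gc].
have gcE l : g l = c by have := gc l; rewrite !ffunE => ->; exact: mulr1.
move: g1 gm; rewrite /inner.
under eq_bigr do rewrite gcE mulrA; under [in X in _ -> X]eq_bigr do rewrite gcE mul1r.
by rewrite -!mulr_suml => + e; rewrite e mul0r => /esym/eqP; rewrite oner_eq0.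
Qed.

(** An eigenfunction for an eigenvalue b other than 1 has mean zero, so the Poincare inequality
    applied to it reads 1 <= K (1 - b). *)
Lemma spectral_gap_ge K : 1 <= K ->
  (forall f, \sum_k \sum_l w k * w l * (f k - f l) ^+ 2 <=
     K * (\sum_k w k) * dirichlet f f) ->
  K^-1 <= spectral_gap M.
Proof.
move=> K1 poinc; have K0 : 0 < K by exact: lt_le_trans K1.
have [ss sc] := eigenvalue_seqP (kernel_op M).
rewrite /spectral_gap /second_largest_eigenvalue -/s.
(* With fewer than two entries, the default value 0 is read at position 1 and the gap is 1; this
   case uses [1 <= K]. *)
have [sz|sz] := leqP (size s) 1; first by rewrite nth_default // subr0 invf_le1.
have [f [[k fk] fE]] := mem_eigenvalue_seqP _ (second_entry_mem sz).
set b := s`_1 in fE *.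
have Wp : 0 < \sum_k w k.
  by rewrite (bigD1 k) //= ltr_pwDl // sumr_ge0 // => l _; rewrite ltW.
have [b1|b1] := eqVneq b 1; last first.
  have fm : inner (fun=> 1) f = 0.
    have := eigenvalue_dirichlet (fun=> 1) fE.
    rewrite dirichletC dirichlet_cst innerC => /esym/eqP.
    by rewrite !mulf_eq0 pnatr_eq0 subr_eq0 (eq_sym 1) (negPf b1) => /eqP.
  have := poinc f; rewrite (eigenvalue_dirichlet f fE).
  have -> : \sum_k \sum_l w k * w l * (f k - f l) ^+ 2 =
      2 * (\sum_k w k) * inner f f.
    transitivity (\sum_k (w k * f k ^+ 2 * (\sum_l w l) + w k * inner f f)
        - 2 * inner (fun=> 1) f * inner (fun=> 1) f).
      rewrite -mulrA mulr_suml mulr_sumr -sumrB; apply: eq_bigr => i _.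
      rewrite /inner !mulr_sumr -big_split /= -sumrB.
      by apply: eq_bigr => j _; ring.
    rewrite fm mulr0 subr0 big_split /= -!mulr_suml.
    rewrite [X in X * _](_ : _ = inner f f); last by [].
    by ring.
  have fp := inner_gt0 fk.
  have -> : K * (\sum_k w k) * (2 * (1 - b) * inner f f) =
    2 * (\sum_k w k) * inner f f * (K * (1 - b)) by ring.
  rewrite ler_pMr ?mulr_gt0 // => Kb.
  by rewrite -[leLHS]mul1r ler_pdivrMr // mulrC.
(* Nonnegativity of the energy bounds all eigenvalues by 1, so b = 1 would be multiple. But the
   Poincare inequality forces functions of zero energy to be constant. *)
exfalso; have : (1 < count_mem b s)%N.
  apply: second_entry_count => // a /mem_eigenvalue_seqP[g [[l gl] gE]].
  have := dirichlet_ge0 g; rewrite (eigenvalue_dirichlet g gE) -/b b1.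
  by rewrite pmulr_lge0 ?inner_gt0 // 1?(inner_gt0 gl) // pmulr_rge0 // subr_ge0.
rewrite sc b1 ltnNge => /negP; apply.
suff eS : (passmx.leigenspace (kernel_op M) 1 <= <[[ffun=> 1] : {ffun T -> R^o}]>)%VS.
  by rewrite (leq_trans (dimvS eS)) // dim_vline; case: eqP.
apply/subvP => g; rewrite mem_leigenspace => /forallP gE.
have gD : dirichlet g g = 0.
  by rewrite (@eigenvalue_dirichlet 1) ?subrr ?mulr0 ?mul0r // => l; apply/eqP.
have := poinc g; rewrite gD mulr0 => g0.
have t0 i j : 0 <= w i * w j * (g i - g j) ^+ 2.
  by rewrite mulr_ge0 ?sqr_ge0 // mulr_ge0 // ltW.
apply/vlineP; exists (g k); apply/ffunP => l; rewrite !ffunE.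
apply/esym; rewrite [LHS]mulr1; apply/eqP; rewrite -subr_eq0.
rewrite -sqrf_eq0 eq_le sqr_ge0 andbT.
rewrite -(pmulr_rle0 _ (mulr_gt0 (w_gt0 k) (w_gt0 l))) (le_trans _ g0) // (bigD1 k) //= (bigD1 l) //= -addrA.
by rewrite lerDl addr_ge0 ?sumr_ge0 // => i _; rewrite sumr_ge0.
Qed.

End ReversibleKernel.

(** * Weighted inequalities on a segment *)

(** Cauchy-Schwarz for the factors c^(-1/2) and c^(1/2) d, proved without square roots. *)
Lemma weighted_cauchy (R : realFieldType) (I : finType) (P : pred I) (c d : I -> R) :
  (forall i, P i -> 0 < c i) ->
  (\sum_(i | P i) d i) ^+ 2 <=
  (\sum_(i | P i) (c i)^-1) * \sum_(i | P i) c i * d i ^+ 2.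
Proof.
move=> c0; rewrite -subr_ge0.
set S := \sum_(i | P i) d i; set A := \sum_(i | P i) (c i)^-1.
have A0 : 0 <= A by apply: sumr_ge0 => i Pi; rewrite invr_ge0 ltW ?c0.
have [a0|a0] := eqVneq A 0.
  suff -> : S = 0 by rewrite a0 mul0r expr0n subrr.
  apply: big1 => i Pi; have := c0 _ Pi; rewrite -invr_gt0 => ci.
  suff : 0 < A by rewrite a0 ltxx.
  rewrite /A (bigD1 i) //= ltr_pwDl // sumr_ge0 // => j /andP[Pj _].
  by rewrite invr_ge0 ltW ?c0.
have Ap : 0 < A by rewrite lt_def a0.
(* The variance of [d / c] for the probability weights [1 / (c A)]. *)
have : 0 <= \sum_(i | P i) c i * (d i - S / A / c i) ^+ 2.
  by apply: sumr_ge0 => i Pi; rewrite mulr_ge0 ?sqr_ge0 // ltW ?c0.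
suff -> : \sum_(i | P i) c i * (d i - S / A / c i) ^+ 2 =
    (\sum_(i | P i) c i * d i ^+ 2) - S ^+ 2 / A.
  set X := \sum_(i | P i) _ => /(mulr_ge0 A0).
  by have -> : A * (X - S ^+ 2 / A) = A * X - S ^+ 2 by field.
transitivity (\sum_(i | P i) c i * d i ^+ 2 - 2 * (S / A) * S + (S / A) ^+ 2 * A).
  rewrite /S /A !mulr_sumr -/S -/A -sumrB -big_split /=; apply: eq_bigr => i Pi.
  by field; rewrite a0 gt_eqF ?c0.
by field.
Qed.

Definition distI n (a b : 'I_n) : nat := `|a%:Z - b%:Z|%N.

Section Segment.
Variables (R : realType) (n : nat).
Implicit Types (a b i j c : 'I_n) (g w : 'I_n -> R).

Lemma distIC a b : distI a b = distI b a.
Proof. by rewrite /distI; lia. Qed.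

Lemma distI_lt a b : (distI a b < n)%N.
Proof. by rewrite /distI; have := ltn_ord a; have := ltn_ord b; lia. Qed.

(** At a given distance from [a], an index is determined by the side of [a] on which it lies. *)
Lemma card_distI_le2 a m : (#|[pred b | distI a b == m]| <= 2)%N.
Proof.
rewrite -card_bool; apply: (leq_card_in (fun b : 'I_n => (a <= b)%N)).
move=> b c; rewrite !inE /distI => ab ac abc; apply: val_inj => /=; lia.
Qed.

Lemma sum_distI_le a m (x : R) : 0 <= x ->
  \sum_(b | distI a b == m) x <= 2 * x.
Proof.
move=> x0; rewrite (sumr_const (fun b => distI a b == m)) -(mulr_natl x).
by rewrite ler_wpM2r // ler_nat card_distI_le2.
Qed.

Lemma sum_radial_le a (h : nat -> R) : (forall m, 0 <= h m) ->
  \sum_b h (distI a b) <= 2 * \sum_(m < n) h m.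
Proof.
move=> h0; rewrite (partition_big (fun b => Ordinal (distI_lt a b)) xpredT) //=.
rewrite mulr_sumr; apply: ler_sum => m _.
rewrite (eq_bigl (fun b => distI a b == m)) //.
by rewrite (eq_bigr (fun=> h m)) ?sum_distI_le // => b /eqP ->.
Qed.

(** The inner sum has at most one term: it encodes the successor of [a] without leaving the ordinal
    type. *)
Lemma telescope_le g i j : (i <= j)%N ->
  `|g i - g j| <= \sum_(a : 'I_n | (i <= a < j)%N) \sum_(b : 'I_n | a.+1 == b) `|g a - g b|.
Proof.
move=> ij; have [m mE] : exists m, (j = i + m :> nat)%N.
  by exists (j - i)%N; rewrite subnKC.
elim: m j mE {ij} => [|m IH] j jE.
  have -> : j = i by apply: val_inj; rewrite /= jE addn0.
  by rewrite subrr normr0 sumr_ge0 // => a _; rewrite sumr_ge0.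
have j'n : (i + m < n)%N by rewrite (leq_trans _ (ltn_ord j)) // jE addnS.
pose j' := Ordinal j'n.
rewrite (bigD1 j') /=; last by rewrite leq_addr jE addnS ltnSn.
rewrite (bigD1 j) /=; last by rewrite jE addnS.
rewrite -(subrKA (g j')) (le_trans (ler_normD _ _)) // addrC.
apply: lerD; last by rewrite lerDl sumr_ge0.
rewrite (le_trans (IH j' erefl)) //.
rewrite [leRHS](eq_bigl (fun a : 'I_n => (i <= a < j')%N)) // => a /=.
by rewrite -val_eqE /= jE; lia.
Qed.

(** The path is enlarged to all oriented edges of the segment, so that the bound no longer depends
    on the endpoints. *)
Lemma telescope_adj_le g i j :
  `|g i - g j| <= \sum_a \sum_(b | distI a b == 1%N) `|g a - g b|.
Proof.
wlog ij : i j / (i <= j)%N.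
  by move=> H; have /orP[/H//|/H] := leq_total i j; rewrite distrC.
rewrite (le_trans (telescope_le g ij)) //.
rewrite [leRHS](bigID (fun a : 'I_n => (i <= a < j)%N)) /=.
rewrite -[leLHS]addr0 lerD //; last by do 2 (apply: sumr_ge0 => ? _).
apply: ler_sum => a _.
rewrite [leRHS](bigID (fun b : 'I_n => a.+1 == b)) /=.
rewrite -[leLHS]addr0 lerD //; last by apply: sumr_ge0 => ? _.
rewrite le_eqVlt (eq_bigl (fun b : 'I_n => (distI a b == 1%N) && (a.+1 == b))) ?eqxx //.
by move=> b; rewrite /distI; lia.
Qed.

(** The conductance [min (w a) (w b)] is four times the Metropolis flow through an edge; each edge
    is counted in both orientations. *)
Definition path_energy w g : R :=
  \sum_a \sum_(b | distI a b == 1%N) Num.min (w a) (w b) * (g a - g b) ^+ 2.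

(** Cauchy-Schwarz over the oriented edges. The inverse of a minimum is at most the sum of the two
    inverses, and each index has at most two neighbours, whence the factor 4. *)
Lemma sqr_diff_le_path_energy w g i j : (forall a, 0 < w a) ->
  (g i - g j) ^+ 2 <= 4 * (\sum_a (w a)^-1) * path_energy w g.
Proof.
move=> w0.
pose c (p : 'I_n * 'I_n) := Num.min (w p.1) (w p.2).
have c0 p : 0 < c p by rewrite /c lt_min !w0.
have := weighted_cauchy (P := fun p : 'I_n * 'I_n => distI p.1 p.2 == 1%N)
  (c := c) (fun p => `|g p.1 - g p.2|) (fun p _ => c0 p).
have -> : \sum_(p | distI p.1 p.2 == 1%N) c p * `|g p.1 - g p.2| ^+ 2 = path_energy w g.
  rewrite /path_energy pair_big_dep /=; apply: eq_bigr => p _.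
  by rewrite real_normK ?num_real.
have := telescope_adj_le g i j; rewrite pair_big_dep /=.
set S := \sum_(p | _) `|_ - _| => le1 le2.
have le3 : (g i - g j) ^+ 2 <= S ^+ 2.
  by rewrite -[leLHS]real_normK ?num_real // lerXn2r ?nnegrE // (le_trans _ le1).
apply: le_trans le3 (le_trans le2 _); apply: ler_wpM2r.
  apply: sumr_ge0 => a _; apply: sumr_ge0 => b _.
  by rewrite mulr_ge0 ?sqr_ge0 // (ltW (c0 (a, b))).
rewrite -(pair_big_dep xpredT (fun a b => distI a b == 1%N) (fun a b => (c (a, b))^-1)) /=.
have min_inv a b : (c (a, b))^-1 <= (w a)^-1 + (w b)^-1.
  have [wa wb] : 0 <= (w a)^-1 /\ 0 <= (w b)^-1 by rewrite !invr_ge0 !ltW.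
  by rewrite /c /=; case: (leP (w a) (w b)) => _; rewrite ?lerDl ?lerDr.
apply: (@le_trans _ _ (\sum_a \sum_(b | distI a b == 1%N) ((w a)^-1 + (w b)^-1))).
  by apply: ler_sum => a _; apply: ler_sum => b _.
have half : \sum_a \sum_(b | distI a b == 1%N) (w a)^-1 <= 2 * \sum_a (w a)^-1.
  rewrite mulr_sumr; apply: ler_sum => a _.
  by rewrite sum_distI_le // invr_ge0 ltW.
have -> : \sum_a \sum_(b | distI a b == 1%N) ((w a)^-1 + (w b)^-1) =
    \sum_a \sum_(b | distI a b == 1%N) (w a)^-1 +
    \sum_a \sum_(b | distI a b == 1%N) (w b)^-1.
  by rewrite -big_split; apply: eq_bigr => a _; rewrite big_split.
rewrite [X in _ + X](exchange_big_dep xpredT) //=.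
under [X in _ + X]eq_bigr do under eq_bigl do rewrite distIC.
lra.
Qed.

Variables (t : 'I_n -> R) (delta : R).
Hypothesis tE : forall a b, t a - t b = delta * (a%:R - b%:R).

Lemma normr_natr_sub a b : `|a%:R - b%:R : R| = (distI a b)%:R.
Proof. by rewrite /distI natr_absz intr_norm rmorphB. Qed.

(* [c] stands for the zero of [t], which need not be in the range of the indices. *)
Lemma affine_center : (0 < n)%N ->
  exists c, forall a, `|delta| * (distI c a)%:R <= 2 * `|t a|.
Proof.
move=> n0.
have [c _ cmin] := Order.TotalTheory.arg_minP (i0 := Ordinal n0)
  (fun a => `|t a|) (erefl true : xpredT (Ordinal n0)).
exists c => a; rewrite distIC -normr_natr_sub -normrM -tE.
by rewrite mulr_natl mulr2n (le_trans (ler_normB _ _)) // lerD // cmin.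
Qed.

(** Uniform as [delta] tends to 0: with m the distance from [c] to [a], it rests on |t b| <= |t a| +
    |delta| n, 1 + m <= n and |delta| m <= 2 |t a|. *)
Lemma affine_ratio_le (D : R) c : 0 <= D -> `|delta| <= D ->
  (forall a, `|delta| * (distI c a)%:R <= 2 * `|t a|) ->
  forall a b, (1 + `|t b|) * (1 + (distI c a)%:R) <= (D + 3) * n%:R * (1 + `|t a|).
Proof.
move=> D0 dD cP a b.
have tb : `|t b| <= `|t a| + `|delta| * n%:R.
  have -> : t b = t a + (t b - t a) by rewrite addrC subrK.
  rewrite (le_trans (ler_normD _ _)) // lerD // tE normrM ler_wpM2l //.
  by rewrite normr_natr_sub ler_nat ltnW // distI_lt.
have ca := cP a.
have mn : 1 + (distI c a)%:R <= n%:R :> R.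
  by rewrite nat1r ler_nat distI_lt.
have m0 : 0 <= (distI c a)%:R :> R by [].
have [d0 ta0 tb0] : [/\ 0 <= `|delta|, 0 <= `|t a| & 0 <= `|t b|] by [].
move: tb ca mn m0 d0 ta0 tb0 dD.
move: (distI c a)%:R n%:R `|t a| `|t b| `|delta| => m k x y d *.
have k1 : 0 <= k by lra.
apply: (@le_trans _ _ ((1 + x) * (1 + m) + d * k * (1 + m))).
  by rewrite -mulrDl ler_wpM2r //; lra.
have : (1 + x) * (1 + m) <= (1 + x) * k by rewrite ler_wpM2l //; lra.
have : d * k * (1 + m) <= k * (D + 2 * x).
  have -> : d * k * (1 + m) = k * (d + d * m) by ring.
  by rewrite ler_wpM2l // lerD.
have : 0 <= D * k * x by rewrite !mulr_ge0.
nra.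
Qed.

Lemma affine_lower (d : R) c : 0 <= d <= 1 -> d <= `|delta| ->
  (forall a, `|delta| * (distI c a)%:R <= 2 * `|t a|) ->
  forall a, d * (1 + (distI c a)%:R) <= 2 * (1 + `|t a|).
Proof.
move=> /andP[d0 d1] dd cP a.
have := cP a; have m0 : 0 <= (distI c a)%:R :> R by [].
have := ler_wpM2r m0 dd; lra.
Qed.

Definition power_sum (alpha : R) : R := \sum_(m < n) (1 + m%:R) `^ (- alpha).

(** On a line where [t] is steep, 1 + |t| is at least d/2 times 1 plus the distance to the centre.
    This controls the energy of the test functions. *)
Lemma affine_sum_le (alpha d : R) : 0 <= alpha -> 0 < d <= 1 -> d <= `|delta| ->
  (0 < n)%N ->
  \sum_a (1 + `|t a|) `^ (- alpha) <= 2 * (2 / d) `^ alpha * power_sum alpha.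
Proof.
move=> al0 /andP[d0 d1] dd n0.
have [c cP] := affine_center n0.
rewrite -mulrA mulrCA.
apply: (@le_trans _ _ ((2 / d) `^ alpha * \sum_a (1 + (distI c a)%:R) `^ (- alpha))).
  rewrite mulr_sumr; apply: ler_sum => a _.
  have la := affine_lower (introT andP (conj (ltW d0) d1)) dd cP a.
  have p1 : 0 < 1 + `|t a| by rewrite ltr_pwDl.
  have p2 : 0 < 1 + (distI c a)%:R :> R by rewrite ltr_pwDl.
  rewrite !powRN ler_pdivlMr ?powR_gt0 // mulrC ler_pdivrMr ?powR_gt0 //.
  rewrite -powRM ?(ltW p1) ?divr_ge0 ?(ltW d0) // ge0_ler_powR // ?nnegrE ?(ltW p2) //.
    by rewrite mulr_ge0 ?divr_ge0 ?ltW.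
  by rewrite mulrAC ler_pdivlMr // mulrC.
rewrite ler_wpM2l ?powR_ge0 //.
apply: (sum_radial_le c (h := fun m => (1 + m%:R) `^ (- alpha))) => m.
exact: powR_ge0.
Qed.

(* Muckenhoupt-type product bound along a grid line. *)
Lemma affine_product_le (alpha D : R) : 0 <= alpha -> 0 <= D -> `|delta| <= D ->
  (0 < n)%N ->
  (\sum_a (1 + `|t a|) `^ alpha) * (\sum_a ((1 + `|t a|) `^ alpha)^-1) <=
  2 * n%:R * ((D + 3) * n%:R) `^ alpha * power_sum alpha.
Proof.
move=> al0 D0 dD n0.
have [c cP] := affine_center n0.
have Kn0 : 0 <= (D + 3) * n%:R by rewrite mulr_ge0 // addr_ge0.
(* The ratio estimate, raised to the power [alpha], bounds each term of the double product
   independently of [a]; summing over [a] gives the factor n. *)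
apply: (@le_trans _ _ (\sum_(a < n) ((D + 3) * n%:R) `^ alpha *
    \sum_b (1 + (distI c b)%:R) `^ (- alpha))).
  rewrite mulr_suml; apply: ler_sum => a _.
  rewrite !mulr_sumr; apply: ler_sum => b _.
  have ab := affine_ratio_le D0 dD cP b a.
  have p1 i : 0 < 1 + `|t i| by rewrite ltr_pwDl.
  have p2 : 0 < 1 + (distI c b)%:R :> R by rewrite ltr_pwDl.
  rewrite powRN ler_pdivrMr ?powR_gt0 // mulrAC ler_pdivlMr ?powR_gt0 //.
  have [q1 q2 q3] : [/\ 0 <= 1 + `|t a|, 0 <= 1 + `|t b| &
    0 <= 1 + (distI c b)%:R :> R] by split; apply: ltW.
  by rewrite -!powRM // ge0_ler_powR // nnegrE mulr_ge0.
rewrite sumr_const card_ord -[leLHS]mulr_natl.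
have := sum_radial_le c (h := fun m => (1 + m%:R) `^ (- alpha)) (fun=> powR_ge0 _ _).
rewrite -/(power_sum _) => le1.
rewrite [leRHS](_ : _ = n%:R * (((D + 3) * n%:R) `^ alpha * (2 * power_sum alpha))).
  by rewrite ler_wpM2l // ler_wpM2l ?powR_ge0.
by ring.
Qed.

End Segment.

(** * Sums of powers *)

Section PowerSums.
Variable R : realType.
Implicit Types (alpha r u : R) (n N : nat).

Lemma ln_le_sub1 u : 0 < u -> ln u <= u - 1.
Proof.
by move=> u0; have := @le_ln1Dx R (u - 1); rewrite subrKC; apply; rewrite ltrBrDl subrr.
Qed.

Lemma powR_le_affine u r : 0 < u -> 0 <= r <= 1 -> u `^ r <= 1 - r + r * u.
Proof.
move=> u0 /andP[r0 r1]; set z := 1 - r + r * u.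
have z0 : 0 < z.
  rewrite /z; have [->|rn0] := eqVneq r 0; first by lra.
  by rewrite ltr_wpDl ?subr_ge0 // mulr_gt0 // lt_def rn0.
have h1 := ln_le_sub1 (divr_gt0 u0 z0).
have h2 : - ln z <= z^-1 - 1 by rewrite -lnV // ln_le_sub1 ?invr_gt0.
rewrite lnM ?posrE ?invr_gt0 // lnV // in h1.
have : r * ln u <= ln z.
  rewrite -subr_ge0.
  have -> : ln z - r * ln u = - (r * (ln u - ln z) + (1 - r) * (- ln z)) by ring.
  rewrite oppr_ge0.
  apply: (@le_trans _ _ (r * (u / z - 1) + (1 - r) * (z^-1 - 1))).
    by rewrite lerD // ler_wpM2l ?subr_ge0.
  have -> : r * (u / z - 1) + (1 - r) * (z^-1 - 1) = z / z - 1 by rewrite /z; ring.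
  by rewrite divff ?subrr // gt_eqF.
by rewrite /powR (gt_eqF u0) -[X in _ -> _ <= X](@lnK _ z) ?posrE // ler_expR.
Qed.

Lemma inv_succ_le_ln n : (0 < n)%N ->
  (1 + n%:R : R)^-1 <= ln (1 + n%:R) - ln n%:R.
Proof.
move=> n0; have np : 0 < n%:R :> R by rewrite ltr0n.
have sp : 0 < 1 + n%:R :> R by rewrite ltr_pwDl.
have := ln_le_sub1 (divr_gt0 np sp).
rewrite lnM ?posrE ?invr_gt0 // lnV //.
have -> : n%:R / (1 + n%:R) - 1 = - (1 + n%:R)^-1 :> R by field; rewrite gt_eqF.
lra.
Qed.

Lemma power_sum_ge1 n alpha : (0 < n)%N -> 1 <= power_sum n alpha.
Proof.
case: n => // n _; rewrite /power_sum big_ord_recl /= addr0 powR1 lerDl.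
by apply: sumr_ge0 => i _; exact: powR_ge0.
Qed.

(** A discrete integral comparison. With r = 1 - alpha, the affine bound at u = n/(n+1) gives r
    (n+1)^(-alpha) <= (n+1)^r - n^r. *)
Lemma power_sum_lt1 n alpha : 0 <= alpha < 1 ->
  power_sum n alpha <= n%:R `^ (1 - alpha) / (1 - alpha).
Proof.
move=> /andP[al0 al1]; have r0 : 0 < 1 - alpha by rewrite subr_gt0.
elim: n => [|n IH].
  by rewrite /power_sum big_ord0 divr_ge0 ?powR_ge0 ?ltW.
rewrite /power_sum big_ord_recr /= -/(power_sum n alpha).
apply: le_trans (lerD IH (lexx _)) _.
rewrite -(ler_pM2r r0) mulrDl !mulfVK ?gt_eqF // -nat1r.
have sp : 0 < 1 + n%:R :> R by rewrite ltr_pwDl.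
have [->|n0] := eqVneq n 0%N.
  by rewrite powR0 ?gt_eqF // !addr0 !powR1; lra.
have np : 0 < n%:R :> R by rewrite ltr0n lt0n.
have r01 : 0 <= 1 - alpha <= 1 by rewrite subr_ge0 ltW //= gerBl.
have := powR_le_affine (divr_gt0 np sp) r01.
have -> : n%:R `^ (1 - alpha) =
    (n%:R / (1 + n%:R)) `^ (1 - alpha) * (1 + n%:R) `^ (1 - alpha) :> R.
  by rewrite -powRM ?divr_ge0 ?(ltW np) ?(ltW sp) // divfK // gt_eqF.
move=> h; apply: le_trans (lerD (ler_wpM2r (powR_ge0 _ _) h) (lexx _)) _.
have -> : (1 + n%:R) `^ (- alpha) = (1 + n%:R) `^ (1 - alpha) / (1 + n%:R) :> R.
  rewrite powRD ?powRr1 ?ltW //; last by rewrite (gt_eqF sp) implybT.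
  by field; rewrite gt_eqF.
move: (_ `^ _) => p; rewrite le_eqVlt; apply/orP; left; apply/eqP.
by field; rewrite gt_eqF.
Qed.

Lemma power_sum_eq1 n : (0 < n)%N -> power_sum n 1 <= 1 + ln (n%:R : R).
Proof.
elim: n => // -[|n] IH _.
  by rewrite /power_sum big_ord1 /= addr0 powR1 ln1 addr0.
rewrite /power_sum big_ord_recr /= -/(power_sum n.+1 1) powR_inv1 ?addr_ge0 //.
have := IH isT; have := inv_succ_le_ln (ltn0Sn n); rewrite -[n.+2%:R]nat1r; lra.
Qed.

Lemma power_sum_gt1 n alpha : 1 < alpha -> power_sum n alpha <= alpha / (alpha - 1).
Proof.
move=> al1; pose r := alpha - 1; have r0 : 0 < r by rewrite subr_gt0.
case: n => [|n].
  by rewrite /power_sum big_ord0 divr_ge0 ?ltW // (lt_trans _ al1).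
(* The subtracted tail makes the induction work; equality holds for a single term, since alpha - 1 =
   r. *)
suff : power_sum n.+1 alpha <= alpha / r - n.+1%:R `^ (- r) / r.
  by move/le_trans; apply; rewrite gerBl divr_ge0 ?powR_ge0 ?ltW.
elim: n => [|n IH].
  rewrite /power_sum big_ord1 /= addr0 !powR1 -mulrBl /r divff //.
  by rewrite gt_eqF.
rewrite /power_sum big_ord_recr /= -/(power_sum n.+1 alpha).
apply: le_trans (lerD IH (lexx _)) _.
rewrite -[n.+2%:R]nat1r; set x : R := n.+1%:R.
have xp : 0 < x by rewrite ltr0n.
have sp : 0 < 1 + x by rewrite ltr_pwDl // ltW.
have : (1 + x) `^ (- r) * (1 + r * (1 + x)^-1) <= x `^ (- r).
  rewrite /powR !gt_eqF //.
  have -> : - r * ln x = - r * ln (1 + x) + r * (ln (1 + x) - ln x) by ring.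
  rewrite expRD ler_wpM2l ?expR_ge0 // (le_trans _ (expR_ge1Dx _)) //.
  by rewrite lerD2l ler_wpM2l ?(ltW r0) // inv_succ_le_ln.
have -> : (1 + x) `^ (- alpha) = (1 + x) `^ (- r) / (1 + x).
  have -> : - alpha = - r + -1 by rewrite /r; ring.
  by rewrite powRD ?powR_inv1 ?(ltW sp) // (gt_eqF sp) implybT.
move: (_ `^ _) (_ `^ _) => p q h.
rewrite -subr_ge0.
have -> : alpha / r - q / r - (alpha / r - p / r + q / (1 + x)) =
  (p - q * (1 + r * (1 + x)^-1)) / r by field; rewrite !gt_eqF.
by apply: divr_ge0; [rewrite subr_ge0|exact: ltW].
Qed.

Lemma rho_gt0 alpha N : (2 <= N)%N -> 0 < rho alpha N.
Proof.
move=> N2; have Np : 0 < N%:R :> R by rewrite ltr0n ltnW.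
rewrite /rho; case: ifP => _; first by rewrite invr_gt0 exprn_gt0.
case: ifP => _; rewrite invr_gt0 ?powR_gt0 // mulr_gt0 ?exprn_gt0 // ln_gt0 //.
by rewrite ltr1n.
Qed.

Lemma ln2_le N : (2 <= N)%N -> 0 < ln (2 : R) <= ln (N%:R).
Proof.
by move=> N2; rewrite ln_gt0 ?ltr1n //= ler_ln ?posrE ?ltr0n ?ler_nat // ltnW.
Qed.

(** In 1 + ln 2 + ln N, the first two terms are absorbed through ln 2 <= ln N. *)
Lemma power_sum_eq1_le_ln N : (2 <= N)%N ->
  power_sum N.*2 1 <= ((ln 2)^-1 + 2) * ln (N%:R : R).
Proof.
move=> N2; have /andP[l2 lN] := ln2_le N2; have N0 := ltnW N2.
have := @power_sum_eq1 N.*2; rewrite double_gt0 => /(_ N0) /le_trans; apply.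
rewrite -muln2 natrM lnM ?posrE ?ltr0n // mulrDl mulrC.
have : 1 <= ln N%:R / ln 2 :> R by rewrite ler_pdivlMr ?mul1r.
rewrite -/(2%:R); lra.
Qed.

(** The three regimes of [rho] come from here: the power sum is O(N^(1-alpha)), O(log N) or O(1) as
    alpha is below, at or above 1. *)
Lemma power_sum_rho alpha : 0 < alpha -> exists2 C : R, 0 < C &
  forall N, (2 <= N)%N ->
    N%:R * N%:R `^ alpha * power_sum N.*2 alpha <= C * (rho alpha N)^-1.
Proof.
move=> al0; rewrite /rho.
have [al1|al1] := ltP alpha 1.
  exists (2 `^ (1 - alpha) / (1 - alpha)); first by rewrite divr_gt0 ?powR_gt0 ?subr_gt0.
  move=> N N2; have Np : 0 < N%:R :> R by rewrite ltr0n ltnW.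
  rewrite invrK; have := @power_sum_lt1 N.*2 alpha; rewrite (ltW al0) al1 => /(_ isT).
  rewrite -muln2 natrM mulrC powRM // => h.
  apply: le_trans (ler_wpM2l _ h) _; first by rewrite mulr_ge0 ?powR_ge0.
  have e : N%:R `^ alpha * N%:R `^ (1 - alpha) = N%:R :> R.
    by rewrite -powRD ?subrKC ?powRr1 // (gt_eqF Np) implybT.
  rewrite [leLHS](_ : _ = N%:R * (N%:R `^ alpha * N%:R `^ (1 - alpha)) *
    ((1 - alpha)^-1 * 2 `^ (1 - alpha))); last by ring.
  by rewrite e -expr2 mulrC [_^-1 * _]mulrC.
have [->|an1] := eqVneq alpha 1.
  exists ((ln 2)^-1 + 2); first by rewrite addr_gt0 ?invr_gt0 ?ln_gt0 ?ltr1n.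
  move=> N N2; rewrite invrK powRr1 // -expr2 mulrCA.
  by rewrite ler_wpM2l ?exprn_ge0 // power_sum_eq1_le_ln.
have {an1}al1 : 1 < alpha by rewrite lt_def an1.
exists (alpha / (alpha - 1)); first by rewrite divr_gt0 ?subr_gt0.
move=> N N2; rewrite invrK powRD ?powRr1 //; last first.
  by rewrite pnatr_eq0 -lt0n (ltnW N2) implybT.
rewrite [leRHS]mulrC [N%:R `^ _ * N%:R]mulrC.
by apply: ler_wpM2l; [rewrite mulr_ge0 ?powR_ge0|exact: power_sum_gt1].
Qed.

End PowerSums.

(** * The Metropolis chain on the grid *)

Section GridDirichlet.
Variables (R : realType) (N : nat) (w : grid N -> R).
Hypothesis w_gt0 : forall k, 0 < w k.
Implicit Types (k l : grid N) (f : grid N -> R).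

Lemma grid_distE k l : grid_dist k l = (distI k.1 l.1 + distI k.2 l.2)%N.
Proof.
by rewrite /grid_dist /distI /Defs.coord; lia.
Qed.

Lemma sum_grid (F : grid N -> R) : \sum_k F k = \sum_a \sum_b F (a, b).
Proof. by rewrite pair_bigA; apply: eq_bigr => -[]. Qed.

Lemma grid_distC k l : grid_dist k l = grid_dist l k.
Proof. by rewrite !grid_distE !(distIC l.1, distIC l.2) // distIC (distIC k.2). Qed.

Lemma sum_neighbors k (F : grid N -> R) :
  \sum_(l | grid_dist k l == 1%N) F l =
  \sum_(b | distI k.2 b == 1%N) F (k.1, b) +
  \sum_(a | distI k.1 a == 1%N) F (a, k.2).
Proof.
have dist0 (a b : 'I_N.*2) : (distI a b == 0%N) = (b == a).
  by rewrite /distI -val_eqE /=; lia.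
have -> : \sum_(b | distI k.2 b == 1%N) F (k.1, b) =
    \sum_(l | (l.1 == k.1) && (distI k.2 l.2 == 1%N)) F l.
  under [RHS]eq_bigr do rewrite [X in F X]surjective_pairing.
  rewrite -(pair_big_dep (pred1 k.1) (fun _ b => distI k.2 b == 1%N)
    (fun a b => F (a, b))) /=.
  by rewrite big_pred1_eq.
have -> : \sum_(a | distI k.1 a == 1%N) F (a, k.2) =
    \sum_(l | (distI k.1 l.1 == 1%N) && (l.2 == k.2)) F l.
  under [RHS]eq_bigr do rewrite [X in F X]surjective_pairing.
  rewrite -(pair_big_dep (fun a => distI k.1 a == 1%N) (fun=> pred1 k.2)
    (fun a b => F (a, b))) /=.
  by apply: eq_bigr => a _; rewrite big_pred1_eq.
rewrite [LHS](bigID (fun l => l.1 == k.1)) /=; congr (_ + _); apply: eq_bigl => l.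
  rewrite andbC grid_distE -dist0; case: eqP => //= ->; lia.
rewrite grid_distE -!dist0.
move: (distI _ _) (distI _ _) => a b; lia.
Qed.

Lemma sum_neighbors_le k (x : R) : 0 <= x ->
  \sum_(l | grid_dist k l == 1%N) x <= 4 * x.
Proof.
move=> x0; rewrite sum_neighbors.
have := sum_distI_le k.1 1 x0; have := sum_distI_le k.2 1 x0; lra.
Qed.

Lemma metropolis_sum1 k : \sum_l metropolis w k l = 1.
Proof.
rewrite (bigD1 k) //= {1}/metropolis eqxx.
rewrite [X in _ + X](eq_bigr (metropolis_move w k)) ?subrK // => l /negPf.
by rewrite /metropolis eq_sym => ->.
Qed.

(** Since w k min(1, w l / w k) = min(w k, w l), the flow is symmetric, which is the source of
    reversibility. *)
Lemma metropolis_flow k l : k != l -> w k * metropolis w k l =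
  if grid_dist k l == 1%N then 4^-1 * Num.min (w k) (w l) else 0.
Proof.
move=> kl; rewrite /metropolis (negPf kl) /metropolis_move.
case: ifP => _; last by rewrite mulr0.
by rewrite mulrCA minr_pMr ?(ltW (w_gt0 k)) // mulr1 [w k * _]mulrC divfK // gt_eqF.
Qed.

Lemma metropolis_rev k l : w k * metropolis w k l = w l * metropolis w l k.
Proof.
have [->//|kl] := eqVneq k l.
have lk : l != k by rewrite eq_sym.
by rewrite !metropolis_flow // grid_distC minC.
Qed.

Lemma metropolis_ge0 k l : k != l -> 0 <= metropolis w k l.
Proof.
move=> kl; rewrite -(pmulr_rge0 _ (w_gt0 k)) metropolis_flow //.
by case: ifP => // _; rewrite mulr_ge0 // le_min !ltW.
Qed.

Lemma dirichlet_metropolis f : dirichlet w (metropolis w) f f =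
  4^-1 * \sum_k \sum_(l | grid_dist k l == 1%N)
    Num.min (w k) (w l) * (f k - f l) ^+ 2.
Proof.
rewrite /dirichlet mulr_sumr; apply: eq_bigr => k _.
rewrite mulr_sumr [RHS]big_mkcond /=; apply: eq_bigr => l _.
have [->|kl] := eqVneq k l; first by rewrite subrr !expr0n !mulr0 if_same.
by rewrite metropolis_flow //; case: ifP => _; ring.
Qed.

Lemma dirichlet_metropolis_lines f : 4 * dirichlet w (metropolis w) f f =
  \sum_a path_energy (fun b => w (a, b)) (fun b => f (a, b)) +
  \sum_b path_energy (fun a => w (a, b)) (fun a => f (a, b)).
Proof.
rewrite dirichlet_metropolis mulrA divff // mul1r.
under eq_bigr do rewrite sum_neighbors.
rewrite big_split /= /path_energy [X in _ = _ + X]exchange_big /= !pair_big /=.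
congr (_ + _); apply: eq_bigr => p _; apply: eq_bigr => b _.
  by rewrite -surjective_pairing.
by rewrite -surjective_pairing.
Qed.

(** * Poincare inequality by row-column paths *)

Section Poincare.
Variable B : R.
Hypothesis col_bound : forall a,
  (\sum_b w (a, b)) * (\sum_b (w (a, b))^-1) <= B.
Hypothesis row_bound : forall b,
  (\sum_a w (a, b)) * (\sum_a (w (a, b))^-1) <= B.

(* Go from [k] to [l] along the row of [k], then along the column of [l]. *)
Lemma metropolis_poincare f :
  \sum_k \sum_l w k * w l * (f k - f l) ^+ 2 <=
  (32 * B) * (\sum_k w k) * dirichlet w (metropolis w) f f.
Proof.
set W := \sum_k w k.
pose P b := \sum_a (w (a, b))^-1; pose P' a := \sum_b (w (a, b))^-1.
pose Q b := path_energy (fun a => w (a, b)) (fun a => f (a, b)).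
pose Q' a := path_energy (fun b => w (a, b)) (fun b => f (a, b)).
have Q0 b : 0 <= Q b.
  apply: sumr_ge0 => a _; apply: sumr_ge0 => a' _.
  by rewrite mulr_ge0 ?sqr_ge0 // le_min !ltW.
have Q'0 b : 0 <= Q' b.
  apply: sumr_ge0 => a _; apply: sumr_ge0 => a' _.
  by rewrite mulr_ge0 ?sqr_ge0 // le_min !ltW.
have W0 : 0 <= W by apply: sumr_ge0 => k _; rewrite ltW.
(* The corner of the path is (l.1, k.2). The 8 is the 4 of the segment estimate times the 2 from
   splitting the square. *)
have step k l : (f k - f l) ^+ 2 <= 8 * (P k.2 * Q k.2) + 8 * (P' l.1 * Q' l.1).
  case: k l => [k1 k2] [l1 l2] /=.
  have h1 := sqr_diff_le_path_energy (fun a => f (a, k2)) k1 l1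
    (fun a => w_gt0 (a, k2)).
  have h2 := sqr_diff_le_path_energy (fun b => f (l1, b)) k2 l2
    (fun b => w_gt0 (l1, b)).
  have h3 : (f (k1, k2) - f (l1, l2)) ^+ 2 <= 2 * (f (k1, k2) - f (l1, k2)) ^+ 2 +
      2 * (f (l1, k2) - f (l1, l2)) ^+ 2.
    move: (f (k1, k2)) (f (l1, k2)) (f (l1, l2)) => x y z; rewrite -subr_ge0.
    have -> : 2 * (x - y) ^+ 2 + 2 * (y - z) ^+ 2 - (x - z) ^+ 2 =
      (x - 2 * y + z) ^+ 2 by ring.
    exact: sqr_ge0.
  rewrite -/(P k2) -/(Q k2) in h1; rewrite -/(P' l1) -/(Q' l1) in h2; lra.
(* The row term depends on [k] only and the column term on [l] only, so the sum over the other
   endpoint contributes the total mass. *)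
apply: (@le_trans _ _ (8 * W * (\sum_k w k * (P k.2 * Q k.2)) +
                       8 * W * (\sum_l w l * (P' l.1 * Q' l.1)))).
  have -> : 8 * W * (\sum_k w k * (P k.2 * Q k.2)) =
      \sum_k \sum_l w k * w l * (8 * (P k.2 * Q k.2)).
    rewrite mulr_sumr; apply: eq_bigr => k _.
    by rewrite /W mulr_sumr mulr_suml; apply: eq_bigr => l _; ring.
  have -> : 8 * W * (\sum_l w l * (P' l.1 * Q' l.1)) =
      \sum_k \sum_l w k * w l * (8 * (P' l.1 * Q' l.1)).
    rewrite exchange_big /= mulr_sumr; apply: eq_bigr => k _.
    by rewrite /W mulr_sumr mulr_suml; apply: eq_bigr => l _; ring.
  rewrite -big_split; apply: ler_sum => k _; rewrite -big_split; apply: ler_sum => l _ /=.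
  by rewrite -mulrDr ler_wpM2l // mulr_ge0 ?ltW.
(* Summing [w] within a row recreates the product of the two sums that [B] controls. *)
have hr : \sum_k w k * (P k.2 * Q k.2) <= B * \sum_b Q b.
  rewrite sum_grid exchange_big mulr_sumr; apply: ler_sum => b _ /=.
  by rewrite -mulr_suml mulrA ler_wpM2r.
have hc : \sum_k w k * (P' k.1 * Q' k.1) <= B * \sum_a Q' a.
  rewrite sum_grid mulr_sumr; apply: ler_sum => b _ /=.
  by rewrite -mulr_suml mulrA ler_wpM2r.
have := dirichlet_metropolis_lines f; rewrite -/(Q' _) -/(Q _) => D4.
have -> : 32 * B * W * dirichlet w (metropolis w) f f =
  8 * W * (B * (4 * dirichlet w (metropolis w) f f)) by ring.
by rewrite D4 mulrDr [_ + B * _]addrC mulrDr lerD // ler_wpM2l // mulr_ge0.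
Qed.

Lemma metropolis_gap_ge : 1 <= B -> (32 * B)^-1 <= spectral_gap (metropolis w).
Proof.
move=> B1; apply: (spectral_gap_ge (w := w)).
- exact: w_gt0.
- exact: metropolis_sum1.
- exact: metropolis_rev.
- exact: metropolis_ge0.
- by lra.
- exact: metropolis_poincare.
Qed.

End Poincare.

(** The energy of an edge is charged to one endpoint; at most four neighbours cancel the 1/4 of the
    proposal. The 2 in the denominator comes from the doubled Dirichlet form. *)
Lemma metropolis_gap_le f (h : grid N -> R) (H V : R) :
  (forall k l, grid_dist k l = 1%N ->
     Num.min (w k) (w l) * (f k - f l) ^+ 2 <= h k) ->
  (forall k, 0 <= h k) -> \sum_k h k <= H ->
  inner w (fun=> 1) f = 0 -> 0 < V -> V <= inner w f f ->
  spectral_gap (metropolis w) <= H / (2 * V).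
Proof.
move=> fh h0 hH fm V0 fV.
have H0 : 0 <= H by rewrite (le_trans _ hH) // sumr_ge0.
have I0 := lt_le_trans V0 fV.
apply: (@spectral_gap_le _ _ w _ _ _ _ _ f) => //.
- exact: metropolis_sum1.
- exact: metropolis_rev.
- exact: metropolis_ge0.
- by rewrite divr_ge0 // mulr_ge0 // ltW.
- by rewrite gt_eqF.
rewrite dirichlet_metropolis.
apply: (@le_trans _ _ H).
  rewrite (le_trans _ hH) // mulr_sumr; apply: ler_sum => k _.
  rewrite ler_pdivrMl // (le_trans _ (sum_neighbors_le k (h0 k))) //.
  by apply: ler_sum => l /eqP; exact: fh.
have -> : 2 * (H / (2 * V)) * inner w f f = H * (inner w f f / V).
  by field; rewrite gt_eqF.
by rewrite -[leLHS]mulr1 ler_wpM2l // ler_pdivlMr // mul1r.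
Qed.

End GridDirichlet.

(** * Weights depending on an affine form *)

Section Involutions.
Variables (R : realType) (T : finType).

Lemma sum_involution_le (s : T -> T) (F m : T -> R) : involutive s ->
  (forall k, m k <= F k + F (s k)) -> \sum_k m k <= 2 * \sum_k F k.
Proof.
move=> sK mF; rewrite mulr_natl mulr2n [X in _ + X](reindex_inj (inv_inj sK)) -big_split.
exact: ler_sum.
Qed.

Lemma sum_odd_eq0 (s : T -> T) (F : T -> R) : involutive s ->
  (forall k, F (s k) = - F k) -> \sum_k F k = 0.
Proof.
move=> sK Fs; apply/eqP; rewrite -[_ == 0](mulrn_eq0 _ 2) mulr2n.
rewrite [X in _ + X](reindex_inj (inv_inj sK)) -big_split big1 // => k _ /=.
by rewrite Fs subrr.
Qed.

(* Two reflections of the index set spread the values of [x] out: half of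
   them have absolute value at least that of [q], and half of those at least [h]. *)
Lemma sum_two_involutions (psi : R -> R) (x q : T -> R) (s1 s2 : T -> T) (h : R) :
  involutive s1 -> involutive s2 -> 0 <= h ->
  (forall u, 0 <= u -> 0 <= psi u) ->
  (forall u v, 0 <= u -> u <= v -> psi u <= psi v) ->
  (forall k, 2 * `|q k| <= `|x k| + `|x (s1 k)|) ->
  (forall k, 2 * h <= `|q k| + `|q (s2 k)|) ->
  #|T|%:R * psi h <= 4 * \sum_k psi `|x k|.
Proof.
move=> s1K s2K h0 psi0 psiM xq qh.
(* The larger of [b] and [c] is at least [a], and [psi] is nondecreasing and nonnegative. *)
have key (a b c : R) : 0 <= a -> 0 <= b -> 0 <= c -> 2 * a <= b + c ->
    psi a <= psi b + psi c.
  move=> a0 b0 c0 abc; have [ab|ba] := leP a b.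
    by rewrite -[leLHS]addr0 lerD ?psiM ?psi0.
  by rewrite -[leLHS]add0r lerD ?psi0 // psiM //; lra.
have h1 : \sum_k psi `|q k| <= 2 * \sum_k psi `|x k|.
  by apply: (sum_involution_le s1K) => k; apply: key.
have h2 : \sum_(k : T) psi h <= 2 * \sum_k psi `|q k|.
  by apply: (sum_involution_le s2K) => k; apply: key.
rewrite sumr_const -[leLHS]mulr_natl in h2; lra.
Qed.

End Involutions.

Section LinearForm.
Variables (R : realType) (N : nat).
Implicit Types (k l : grid N) (a b : 'I_N.*2).

(* The coordinate of index [a], minus 1/2. *)
Definition pos a : R := a%:R - N%:R + 2^-1.

Lemma pos_rev a : pos (rev_ord a) = - pos a.
Proof.
have e : N.*2%:R = 2 * N%:R :> R by rewrite -mul2n natrM.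
by rewrite /pos /= natrB // e -nat1r; field.
Qed.

Lemma pos_sub a b : pos a - pos b = a%:R - b%:R.
Proof. by rewrite /pos; ring. Qed.

Lemma normr_pos_le a : `|pos a| <= N%:R.
Proof.
have : a.+1%:R <= N.*2%:R :> R by rewrite ler_nat.
rewrite [X in _ <= X%:R](esym (muln2 N)) natrM -nat1r /pos ler_norml => h.
have h0 : 0 <= a%:R :> R by [].
by apply/andP; split; lra.
Qed.

Fact half_turn_subproof a : ((if a < N then a + N else a - N) < N.*2)%N.
Proof. by have := ltn_ord a; case: ifP; lia. Qed.

(** Translation by N modulo 2N. It moves every position by exactly N, so one of the two positions
    has absolute value at least N/2. *)
Definition half_turn a := Ordinal (half_turn_subproof a).

Lemma half_turnK : involutive half_turn.
Proof.
move=> a; apply: val_inj => /=; have := ltn_ord a.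
by case: (ltnP a N) => aN h; case: ifP; lia.
Qed.

Lemma pos_half_turn a : N%:R <= `|pos a| + `|pos (half_turn a)|.
Proof.
apply: le_trans (ler_normB _ _); rewrite pos_sub /=.
case: ltnP => aN.
  by rewrite natrD opprD addrA subrr sub0r normrN ger0_norm.
by rewrite natrB // opprB addrCA subrr addr0 ger0_norm.
Qed.

Variables d1 d2 : R.

Definition lin k : R := d1 * pos k.1 + d2 * pos k.2.

Definition point_reflection k : grid N := (rev_ord k.1, rev_ord k.2).

Lemma point_reflectionK : involutive point_reflection.
Proof. by move=> [a b]; rewrite /point_reflection /= !rev_ordK. Qed.

Lemma lin_point_reflection k : lin (point_reflection k) = - lin k.
Proof. by rewrite /lin /= !pos_rev; ring. Qed.

Variables (D d : R).
Hypotheses (d1D : `|d1| <= D) (d2D : `|d2| <= D).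

Lemma lin_step k l : grid_dist k l = 1%N -> `|lin k - lin l| <= D.
Proof.
rewrite grid_distE => kl.
have -> : lin k - lin l = d1 * (pos k.1 - pos l.1) + d2 * (pos k.2 - pos l.2).
  by rewrite /lin; ring.
rewrite !pos_sub (le_trans (ler_normD _ _)) // !normrM !normr_natr_sub.
have -> : D = D * (distI k.1 l.1)%:R + D * (distI k.2 l.2)%:R.
  by rewrite -mulrDr -natrD kl mulr1.
by rewrite lerD // ler_wpM2r.
Qed.

Lemma normr_lin_le k : `|lin k| <= 2 * D * N%:R.
Proof.
rewrite /lin (le_trans (ler_normD _ _)) // !normrM.
have := ler_pM (normr_ge0 d1) (normr_ge0 (pos k.1)) d1D (normr_pos_le _).
have := ler_pM (normr_ge0 d2) (normr_ge0 (pos k.2)) d2D (normr_pos_le _).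
lra.
Qed.

Lemma lin_row a a' b : lin (a, b) - lin (a', b) = d1 * (a%:R - a'%:R).
Proof. by rewrite -pos_sub /lin /=; ring. Qed.

Lemma lin_col a b b' : lin (a, b) - lin (a, b') = d2 * (b%:R - b'%:R).
Proof. by rewrite -pos_sub /lin /=; ring. Qed.

Hypotheses (N0 : (0 < N)%N) (d01 : 0 < d <= 1).
Hypothesis dd : d <= `|d1| \/ d <= `|d2|.

(** Reflecting the coordinate other than the steep one averages [lin] to its steep part, and the
    half turn makes that part at least dN/2 at one of two points. So at least a quarter of the 4 N^2
    points satisfy |lin| >= dN/2. *)
Lemma sum_lin_ge (psi : R -> R) :
  (forall u, 0 <= u -> 0 <= psi u) ->
  (forall u v, 0 <= u -> u <= v -> psi u <= psi v) ->
  N%:R ^+ 2 * psi (d * N%:R / 2) <= \sum_k psi `|lin k|.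
Proof.
move=> psi0 psiM; have /andP[d0 _] := d01.
have h0 : 0 <= d * N%:R / 2 by rewrite divr_ge0 // mulr_ge0 // ltW.
suff : #|{: grid N}|%:R * psi (d * N%:R / 2) <= 4 * \sum_k psi `|lin k|.
  rewrite card_prod card_ord -muln2 !natrM => h.
  rewrite -(ler_pM2l (_ : 0 < 4 :> R)) // (le_trans _ h) //.
  by rewrite le_eqVlt; apply/orP; left; apply/eqP; ring.
have qh (c : R) a : d <= `|c| ->
    2 * (d * N%:R / 2) <= `|c * pos a| + `|c * pos (half_turn a)|.
  move=> dc; rewrite !normrM -mulrDr.
  have -> : 2 * (d * N%:R / 2) = d * N%:R by field.
  by apply: ler_pM => //; [exact: ltW|exact: pos_half_turn].
case: dd => dc.
  apply: (sum_two_involutions (q := fun k => d1 * pos k.1)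
    (s1 := fun k => (k.1, rev_ord k.2)) (s2 := fun k => (half_turn k.1, k.2))) => //.
  - by move=> [a b]; rewrite /= rev_ordK.
  - by move=> [a b]; rewrite /= half_turnK.
  - move=> k; rewrite -normr_nat -normrM.
    have -> : 2%:R * (d1 * pos k.1) = lin k + lin (k.1, rev_ord k.2).
      by rewrite /lin /= pos_rev; ring.
    exact: ler_normD.
  - by move=> k; exact: qh.
apply: (sum_two_involutions (q := fun k => d2 * pos k.2)
  (s1 := fun k => (rev_ord k.1, k.2)) (s2 := fun k => (k.1, half_turn k.2))) => //.
- by move=> [a b]; rewrite /= rev_ordK.
- by move=> [a b]; rewrite /= half_turnK.
- move=> k; rewrite -normr_nat -normrM.
  have -> : 2%:R * (d2 * pos k.2) = lin k + lin (rev_ord k.1, k.2).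
    by rewrite /lin /= pos_rev; ring.
  exact: ler_normD.
- by move=> k; exact: qh.
Qed.

Variable alpha : R.
Hypothesis alpha0 : 0 < alpha.

Definition linweight k : R := (1 + `|lin k|) `^ alpha.

Lemma linweight_gt0 k : 0 < linweight k.
Proof. by rewrite powR_gt0 // ltr_pwDl. Qed.

(** The grid is cut into 2N lines parallel to a steep axis, and each line is bounded separately. *)
Lemma sum_lin_inv_le : \sum_k (1 + `|lin k|) `^ (- alpha) <=
  N.*2%:R * (2 * (2 / d) `^ alpha * power_sum N.*2 alpha).
Proof.
have N20 : (0 < N.*2)%N by rewrite double_gt0.
rewrite sum_grid; case: dd => dc; first rewrite exchange_big /=.
all: rewrite -[X in X%:R * _](card_ord N.*2) mulr_natl -sumr_const.
all: apply: ler_sum => b _.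
  exact: (affine_sum_le (fun a a' => lin_row a a' b) (ltW alpha0) d01 dc N20).
exact: (affine_sum_le (fun a a' => lin_col b a a') (ltW alpha0) d01 dc N20).
Qed.

Lemma linweight_gap_ge : 0 <= D ->
  (64 * N.*2%:R * ((D + 3) * N.*2%:R) `^ alpha * power_sum N.*2 alpha)^-1 <=
  spectral_gap (metropolis linweight).
Proof.
move=> D0; have N20 : (0 < N.*2)%N by rewrite double_gt0.
have -> : 64 * N.*2%:R * ((D + 3) * N.*2%:R) `^ alpha * power_sum N.*2 alpha =
  32 * (2 * N.*2%:R * ((D + 3) * N.*2%:R) `^ alpha * power_sum N.*2 alpha) by ring.
apply: metropolis_gap_ge.
- exact: linweight_gt0.
- move=> a; exact: (affine_product_le (lin_col a) (ltW alpha0) D0 d2D N20).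
- move=> b.
  exact: (affine_product_le (fun a a' => lin_row a a' b) (ltW alpha0) D0 d1D N20).
- have p1 := power_sum_ge1 alpha N20.
  have p2 : 1 <= N.*2%:R :> R by rewrite ler1n.
  have p3 : 1 <= ((D + 3) * N.*2%:R) `^ alpha.
    apply: (@le_trans _ _ (1 `^ alpha)); first by rewrite powR1.
    apply: ge0_ler_powR; rewrite ?nnegrE ?ler01 ?(ltW alpha0) ?mulr_ge0 ?addr_ge0 //.
    by rewrite -[leLHS]mulr1 ler_pM //; lra.
  by rewrite !mulr_ege1 // ler1n.
Qed.

(** Oddness of [phi] and the point reflection give mean zero. The squared norm is bounded below
    because (1 + u)^alpha phi(u)^2 is nondecreasing on u >= 0. *)
Lemma linweight_gap_le (phi : R -> R) (h : grid N -> R) (H V : R) :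
  (forall u, phi (- u) = - phi u) ->
  (forall u, 0 <= u -> 0 <= phi u) ->
  (forall u v, 0 <= u -> u <= v -> phi u <= phi v) ->
  (forall k l, grid_dist k l = 1%N ->
     Num.min (linweight k) (linweight l) * (phi (lin k) - phi (lin l)) ^+ 2 <= h k) ->
  (forall k, 0 <= h k) -> \sum_k h k <= H -> 0 < V ->
  V <= N%:R ^+ 2 * ((1 + d * N%:R / 2) `^ alpha * phi (d * N%:R / 2) ^+ 2) ->
  spectral_gap (metropolis linweight) <= H / (2 * V).
Proof.
move=> phiN phi0 phiM hE h0 hH V0 VE.
apply: (@metropolis_gap_le _ _ _ _ (fun k => phi (lin k)) h) => //.
- exact: linweight_gt0.
- apply: (sum_odd_eq0 point_reflectionK) => k.
  by rewrite /linweight lin_point_reflection normrN phiN; ring.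
apply: le_trans VE _.
have psi0 u : 0 <= u -> 0 <= (1 + u) `^ alpha * phi u ^+ 2.
  by move=> _; rewrite mulr_ge0 ?powR_ge0 ?sqr_ge0.
have psiM u v : 0 <= u -> u <= v ->
    (1 + u) `^ alpha * phi u ^+ 2 <= (1 + v) `^ alpha * phi v ^+ 2.
  move=> u0 uv; have v0 := le_trans u0 uv.
  apply: ler_pM; rewrite ?powR_ge0 ?sqr_ge0 //.
    by rewrite ge0_ler_powR ?nnegrE ?addr_ge0 ?lerD2l // ltW.
  by rewrite lerXn2r ?nnegrE ?phi0 ?phiM.
apply: (le_trans (sum_lin_ge psi0 psiM)).
rewrite le_eqVlt; apply/orP; left; apply/eqP; apply: eq_bigr => k _.
rewrite /linweight -expr2; congr (_ * _).
have [t0|t0] := leP 0 (lin k); first by rewrite ger0_norm.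
by rewrite ltr0_norm // phiN sqrrN.
Qed.

End LinearForm.

(** * Test functions *)

Section TestFunctions.
Variable R : realType.
Implicit Types (s t u v D alpha : R).

Definition slog t : R := Num.sg t * ln (1 + `|t|).

Lemma slogN t : slog (- t) = - slog t.
Proof. by rewrite /slog sgrN normrN mulNr. Qed.

Lemma slog_ge0E t : 0 <= t -> slog t = ln (1 + t).
Proof.
rewrite le_eqVlt => /predU1P[<-|t0]; first by rewrite /slog sgr0 mul0r addr0 ln1.
by rewrite /slog gtr0_sg // mul1r gtr0_norm.
Qed.

Lemma ln_lip u v : 0 <= u -> u <= v ->
  (1 + u) * (ln (1 + v) - ln (1 + u)) <= v - u.
Proof.
move=> u0 uv; have pu : 0 < 1 + u by rewrite ltr_pwDl.
have pv : 0 < 1 + v by lra.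
have := ln_le_sub1 (divr_gt0 pv pu).
rewrite lnM ?posrE ?invr_gt0 // lnV // => h.
apply: le_trans (ler_wpM2l (ltW pu) h) _.
by rewrite mulrBr mulr1 mulrCA divff ?gt_eqF // mulr1; lra.
Qed.

(** The derivative of [slog] is 1/(1 + |t|). By symmetry, [s] may be taken nonnegative and of
    smaller modulus. *)
Lemma slog_lip s t D : 1 <= D -> `|s - t| <= D ->
  (1 + Num.min `|s| `|t|) * `|slog s - slog t| <= (1 + D) * D.
Proof.
move=> D1.
wlog st : s t / `|s| <= `|t|.
  move=> H; have /orP[/H//|/H] := le_total `|s| `|t|.
  by rewrite minC [`|t - s|]distrC [`|slog t - _|]distrC.
rewrite (min_idPl st).
wlog s0 : s t st / 0 <= s.
  move=> H; have [/H|s0 h] := leP 0 s; first exact.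
  have := H (- s) (- t); rewrite !normrN !slogN -!opprD !normrN; apply => //.
  by rewrite oppr_ge0 ltW.
rewrite ger0_norm // in st *.
have [t0|t0] := leP 0 t => std.
  rewrite ger0_norm // in st; rewrite !slog_ge0E //.
  have ls : ln (1 + s) <= ln (1 + t) by rewrite ler_ln ?posrE ?ltr_pwDl // lerD2l.
  rewrite distrC ger0_norm ?subr_ge0 // (le_trans (ln_lip s0 st)) //.
  have := ler_norm (t - s); rewrite distrC => h; nra.
(* Opposite signs: s - t <= D keeps both points within D of 0, and the two logarithms add up to at
   most s - t. *)
rewrite ltr0_norm // in st.
have -> : t = - (- t) by rewrite opprK.
rewrite slogN opprK !slog_ge0E // ?oppr_ge0 ?(ltW t0) //.
have p1 : 0 < 1 + s by rewrite ltr_pwDl.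
have p2 : 0 < 1 - t by lra.
have h1 := ln_le_sub1 p1; have h2 := ln_le_sub1 p2.
have l1 : 0 <= ln (1 + s) by rewrite ln_ge0 // lerDl.
have l2 : 0 <= ln (1 - t) by rewrite ln_ge0 //; lra.
have h3 := le_trans (ler_norm (s - t)) std.
rewrite ger0_norm ?addr_ge0 //.
by apply: ler_pM; rewrite ?addr_ge0 //; lra.
Qed.

(** With m the smaller modulus, square the Lipschitz bound and divide by 1 + m; passing from 1 + m
    to 1 + |s| costs another factor 1 + D. *)
Lemma slog_edge s t D : 1 <= D -> `|s - t| <= D ->
  Num.min (1 + `|s|) (1 + `|t|) * (slog s - slog t) ^+ 2 <=
  (1 + D) ^+ 3 * D ^+ 2 * (1 + `|s|)^-1.
Proof.
move=> D1 st; have h := slog_lip D1 st; rewrite -addr_minr.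
set m := Num.min _ _ in h *; set x := slog s - slog t in h *.
have m0 : 0 <= m by rewrite le_min !normr_ge0.
have sm : `|s| <= m + D.
  rewrite /m; case: (leP `|s| `|t|) => _; first by rewrite lerDl; lra.
  have := ler_normD (s - t) t; rewrite subrK; lra.
have s0 := normr_ge0 s; move: `|s| s0 sm => y y0 ym.
have hx : x ^+ 2 = `|x| ^+ 2 by rewrite real_normK ?num_real.
rewrite hx; have x0 := normr_ge0 x; move: `|x| x0 h => z z0 h.
rewrite ler_pdivlMr ?ltr_pwDl //.
have h2 : ((1 + m) * z) ^+ 2 <= ((1 + D) * D) ^+ 2.
  by rewrite lerXn2r ?nnegrE ?mulr_ge0 ?addr_ge0 //; lra.
apply: (@le_trans _ _ (((1 + m) * z) ^+ 2 * (1 + D))).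
  have -> : ((1 + m) * z) ^+ 2 * (1 + D) = (1 + m) * z ^+ 2 * ((1 + m) * (1 + D)).
    by ring.
  by apply: ler_wpM2l; [rewrite mulr_ge0 ?sqr_ge0 ?addr_ge0|nra].
apply: le_trans (ler_wpM2r _ h2) _; first by lra.
by rewrite le_eqVlt; apply/orP; left; apply/eqP; ring.
Qed.

Definition clamp t : R := Num.max (-1) (Num.min 1 t).

Lemma clampN t : clamp (- t) = - clamp t.
Proof. by rewrite /clamp oppr_max oppr_min opprK max_minr (max_idPr _) //; lra. Qed.

(** Two ends beyond D lie on the same side, where [clamp] is constant. Otherwise the smaller weight
    is at most (1 + D)^alpha, and the last two factors on the right have product at least 1; they
    put the bound in a form summable over the grid. *)
Lemma clamp_edge s t D alpha : 0 <= alpha -> 1 <= D -> `|s - t| <= D ->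
  Num.min ((1 + `|s|) `^ alpha) ((1 + `|t|) `^ alpha) * (clamp s - clamp t) ^+ 2 <=
  4 * (1 + D) `^ alpha * (1 + 2 * D) `^ alpha * (1 + `|s|) `^ (- alpha).
Proof.
move=> al0 D1 st.
have rhs0 : 0 <= 4 * (1 + D) `^ alpha * (1 + 2 * D) `^ alpha * (1 + `|s|) `^ (- alpha).
  by rewrite !mulr_ge0 ?powR_ge0.
have sD := ler_normD (s - t) t; rewrite subrK in sD.
have [/andP[sD1 tD1]|mD] := boolP ((D < `|s|) && (D < `|t|)).
  suff -> : clamp s = clamp t by rewrite subrr expr0n mulr0.
  move: st sD1 tD1; rewrite /clamp ler_norml => /andP[h1 h2].
  rewrite !ltr_normr => /orP[] h3 /orP[] h4; try lra.
    by rewrite !(min_idPl _) //; lra.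
  by rewrite !(min_idPr _) ?(max_idPl _) //; lra.
(* The edges along which [clamp] varies stay within [2 * D] of the line. *)
have {}mD : `|s| <= D \/ `|t| <= D.
  by move: mD; rewrite negb_and -!leNgt => /orP.
have s2D : `|s| <= 2 * D by case: mD; lra.
have p0 : 0 < 1 + `|s| by rewrite ltr_pwDl.
rewrite powRN ler_pdivlMr ?powR_gt0 //.
have sq4 : (clamp s - clamp t) ^+ 2 <= 4.
  have cb (x : R) : -1 <= clamp x <= 1.
    by rewrite /clamp le_max lexx /= ge_max ge_min lexx /= andbT; lra.
  have /andP[a1 a2] := cb s; have /andP[b1 b2] := cb t.
  nra.
have mon (x y : R) : 0 <= x -> x <= y -> (1 + x) `^ alpha <= (1 + y) `^ alpha.
  by move=> x0 xy; rewrite ge0_ler_powR ?nnegrE ?lerD2l //; lra.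
have h1 : Num.min ((1 + `|s|) `^ alpha) ((1 + `|t|) `^ alpha) <= (1 + D) `^ alpha.
  by case: mD => h; rewrite ge_min (mon _ _ (normr_ge0 _) h) ?orbT.
rewrite [4 * _]mulrC.
have min0 : 0 <= Num.min ((1 + `|s|) `^ alpha) ((1 + `|t|) `^ alpha).
  by rewrite le_min !powR_ge0.
apply: ler_pM; first exact: mulr_ge0 (sqr_ge0 _).
- exact: powR_ge0.
- by apply: ler_pM; rewrite ?sqr_ge0.
- exact: mon.
Qed.

End TestFunctions.

Ltac positive := repeat first [ done | apply: divr_gt0 | apply: mulr_gt0
  | apply: exprn_gt0 | apply: powR_gt0 | apply: addr_gt0 | rewrite invr_gt0 ].

(** * Gap bounds of order [rho] for affine weights *)

Section UpperBound.
Variables (R : realType) (alpha D d : R).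
Hypotheses (alpha0 : 0 < alpha) (D1 : 1 <= D) (d01 : 0 < d <= 1).

Let gap_bound C := forall (N : nat) (d1 d2 : R), (2 <= N)%N ->
  `|d1| <= D -> `|d2| <= D -> (d <= `|d1| \/ d <= `|d2|) ->
  spectral_gap (metropolis (linweight (N := N) d1 d2 alpha)) <= C * rho alpha N.

(** The energy is O(N^(2+alpha)), because 1 + |t| <= 1 + 2DN <= 3DN, and the variance is at least of
    order N^(4+alpha). *)
Lemma linweight_gap_le_rho_lt1 : alpha < 1 -> exists2 C, 0 < C & gap_bound C.
Proof.
move=> al1; have /andP[d0 d_le1] := d01; have D0 := lt_le_trans ltr01 D1.
exists (8 * D ^+ 2 / d ^+ 2 * ((3 * D) `^ alpha / (d / 2) `^ alpha)).
  by positive.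
move=> N d1 d2 N2 d1D d2D dd.
have N1 : 1 <= N%:R :> R by rewrite ler1n ltnW.
have Np : 0 < N%:R :> R by lra.
have cp : 0 < d / 2 by lra.
have DN : 1 <= D * N%:R by rewrite mulr_ege1.
pose H := N.*2%:R ^+ 2 * ((3 * D * N%:R) `^ alpha * D ^+ 2).
pose V := N%:R ^+ 2 * ((d / 2 * N%:R) `^ alpha * (d / 2 * N%:R) ^+ 2).
have -> : 8 * D ^+ 2 / d ^+ 2 * ((3 * D) `^ alpha / (d / 2) `^ alpha) * rho alpha N =
    H / (2 * V).
  rewrite /rho al1 /H /V !(powRM _ _ (ltW Np)) ?(ltW cp) //; last first.
    by rewrite mulr_ge0 // ltW.
  rewrite -mul2n natrM.
  have n1 : (d / 2) `^ alpha != 0 by rewrite gt_eqF // powR_gt0.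
  have n2 : N%:R `^ alpha != 0 :> R by rewrite gt_eqF // powR_gt0.
  by field; rewrite n1 n2 !gt_eqF.
apply: (linweight_gap_le d01 dd alpha0 (phi := id)
  (h := fun=> (3 * D * N%:R) `^ alpha * D ^+ 2)) => //.
- move=> k l kl; have st := lin_step d1D d2D kl.
  apply: ler_pM; rewrite ?sqr_ge0 ?le_min ?powR_ge0 //.
    rewrite ge_min; apply/orP; left.
    have := normr_lin_le d1D d2D k => h.
    by rewrite ge0_ler_powR ?(ltW alpha0) ?nnegrE ?addr_ge0 ?mulr_ge0 ?(ltW D0) //; lra.
  by rewrite -[leLHS]real_normK ?num_real // lerXn2r ?nnegrE // ltW.
- by move=> k; rewrite mulr_ge0 ?powR_ge0 ?sqr_ge0.
- rewrite sumr_const card_prod card_ord -[leLHS]mulr_natl natrM -expr2.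
  by rewrite /H.
- by rewrite /V; positive.
have -> : d * N%:R / 2 = d / 2 * N%:R by rewrite mulrAC.
have dN : 0 <= d / 2 * N%:R by rewrite mulr_ge0 // ltW.
rewrite /V ler_wpM2l ?sqr_ge0 // ler_wpM2r ?sqr_ge0 //.
by rewrite ge0_ler_powR ?(ltW alpha0) ?nnegrE ?addr_ge0 // lerDr.
Qed.

(** The energy is O(N log N) and the variance at least of order N^3 (log N)^2. *)
Lemma linweight_gap_le_rho_eq1 : alpha = 1 -> exists2 C, 0 < C & gap_bound C.
Proof.
move=> al1; have /andP[d0 d_le1] := d01; have D0 := lt_le_trans ltr01 D1.
pose c : R := (ln 2)^-1 + 2.
have c0 : 0 < c by rewrite addr_gt0 // invr_gt0 ln_gt0 // ltr1n.
exists (((1 + D) ^+ 3 * D ^+ 2) * (4 / d) * c / (d / 2) ^+ 3).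
  by positive.
move=> N d1 d2 N2 d1D d2D dd.
have N1 : 1 <= N%:R :> R by rewrite ler1n ltnW.
have Np : 0 < N%:R :> R by lra.
have cp : 0 < d / 2 by lra.
have /andP[l2 lN] := ln2_le R N2; have lnp : 0 < ln (N%:R : R) by exact: lt_le_trans lN.
pose H := ((1 + D) ^+ 3 * D ^+ 2) * (N.*2%:R * (4 / d) * (c * ln N%:R)).
pose V := N%:R ^+ 2 * ((d / 2 * N%:R) * (d / 2 * ln N%:R) ^+ 2).
have -> : ((1 + D) ^+ 3 * D ^+ 2) * (4 / d) * c / (d / 2) ^+ 3 * rho alpha N =
    H / (2 * V).
  rewrite /rho al1 ltxx eqxx /H /V -mul2n natrM.
  by field; rewrite !gt_eqF.
apply: (linweight_gap_le d01 dd alpha0 (phi := @slog R)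
  (h := fun k => (1 + D) ^+ 3 * D ^+ 2 * (1 + `|lin d1 d2 k|)^-1)).
- exact: slogN.
- by move=> u u0; rewrite slog_ge0E // ln_ge0 // lerDl.
- move=> u v u0 uv; rewrite !slog_ge0E ?(le_trans u0) //.
  by rewrite ler_ln ?posrE ?lerD2l //; lra.
- move=> k l kl; rewrite /linweight al1 !powRr1 ?addr_ge0 //.
  exact: slog_edge (lin_step d1D d2D kl).
- by move=> k; rewrite !mulr_ge0 ?exprn_ge0 ?invr_ge0 ?addr_ge0 // ltW.
- rewrite -mulr_sumr /H ler_wpM2l ?mulr_ge0 ?exprn_ge0 ?addr_ge0 ?(ltW D0) //.
  have := sum_lin_inv_le (ltnW N2) d01 dd alpha0.
  rewrite al1 powRr1 ?divr_ge0 ?(ltW d0) //.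
  under eq_bigr do rewrite powR_inv1 ?addr_ge0 //.
  move=> /le_trans; apply; rewrite -[leRHS]mulrA ler_wpM2l //.
  have -> : 2 * (2 / d) = 4 / d by rewrite mulrA -natrM.
  by rewrite ler_wpM2l ?divr_ge0 ?(ltW d0) // power_sum_eq1_le_ln.
- by rewrite /V; positive.
have -> : d * N%:R / 2 = d / 2 * N%:R by rewrite mulrAC.
have dN : 0 <= d / 2 * N%:R by rewrite mulr_ge0 // ltW.
rewrite al1 powRr1 ?addr_ge0 // slog_ge0E // /V ler_wpM2l ?sqr_ge0 //.
apply: ler_pM; rewrite ?sqr_ge0 ?lerDr //.
rewrite lerXn2r ?nnegrE ?ln_ge0 ?lerDl //; first by rewrite mulr_ge0 // ltW.
(* (d/2) ln N <= ln(1 + dN/2) follows from N^(d/2) <= 1 - d/2 + (d/2) N. *)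
rewrite -ln_powR ler_ln ?posrE ?powR_gt0 //; last by rewrite ltr_pwDl.
have d21 : 0 <= d / 2 <= 1 by apply/andP; split; lra.
by apply: le_trans (powR_le_affine Np d21) _; lra.
Qed.

(** The energy is O(N), concentrated near the line, and the variance is at least of order
    N^(2+alpha). *)
Lemma linweight_gap_le_rho_gt1 : 1 < alpha -> exists2 C, 0 < C & gap_bound C.
Proof.
move=> al1; have /andP[d0 d_le1] := d01; have D0 := lt_le_trans ltr01 D1.
pose K := 4 * (1 + D) `^ alpha * (1 + 2 * D) `^ alpha.
have K0 : 0 < K by rewrite /K; positive.
pose S := alpha / (alpha - 1).
have S0 : 0 < S by rewrite divr_gt0 ?subr_gt0.
exists (K * (2 * (2 / d) `^ alpha * S) / ((d / 2) `^ alpha * d ^+ 2)).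
  by positive.
move=> N d1 d2 N2 d1D d2D dd.
have N1 : 2 <= N%:R :> R by rewrite ler_nat.
have Np : 0 < N%:R :> R by lra.
have cp : 0 < d / 2 by lra.
pose H := K * (N.*2%:R * (2 * (2 / d) `^ alpha * S)).
pose V := N%:R ^+ 2 * ((d / 2 * N%:R) `^ alpha * d ^+ 2).
have -> : K * (2 * (2 / d) `^ alpha * S) / ((d / 2) `^ alpha * d ^+ 2) * rho alpha N =
    H / (2 * V).
  rewrite /rho ltNge (ltW al1) /= gt_eqF // /H /V -mul2n natrM.
  rewrite (powRM _ (ltW cp) (ltW Np)) powRD ?powRr1 ?(ltW Np) //; last first.
    by rewrite (gt_eqF Np) implybT.
  have n1 : (d / 2) `^ alpha != 0 by rewrite gt_eqF // powR_gt0.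
  have n2 : N%:R `^ alpha != 0 :> R by rewrite gt_eqF // powR_gt0.
  by field; rewrite n1 n2 !gt_eqF.
apply: (linweight_gap_le d01 dd alpha0 (phi := @clamp R)
  (h := fun k => K * (1 + `|lin d1 d2 k|) `^ (- alpha))).
- exact: clampN.
- by move=> u u0; rewrite /clamp le_max le_min u0 ler01 orbT.
- move=> u v _ uv; rewrite /clamp ge_max !le_max lexx /= le_min !ge_min lexx uv.
  by rewrite !orbT.
- move=> k l kl; exact: clamp_edge (ltW alpha0) D1 (lin_step d1D d2D kl).
- by move=> k; rewrite mulr_ge0 ?powR_ge0 // ltW.
- rewrite -mulr_sumr /H ler_wpM2l ?(ltW K0) //.
  apply: (le_trans (sum_lin_inv_le (ltnW N2) d01 dd alpha0)).
  by rewrite ler_wpM2l // ler_wpM2l ?mulr_ge0 ?powR_ge0 // power_sum_gt1.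
- by rewrite /V; positive.
have -> : d * N%:R / 2 = d / 2 * N%:R by rewrite mulrAC.
have dN : 0 <= d / 2 * N%:R by rewrite mulr_ge0 // ltW.
(* The point dN/2 may lie below the truncation level 1; as N >= 2 and d <= 1, [clamp] is still at
   least d there. *)
have ddN : d <= d / 2 * N%:R by rewrite mulrAC ler_pdivlMr // ler_wpM2l // ltW.
rewrite /V ler_wpM2l ?sqr_ge0 //; apply: ler_pM; rewrite ?powR_ge0 ?sqr_ge0 //.
  by rewrite ge0_ler_powR ?(ltW alpha0) ?nnegrE ?addr_ge0 // lerDr.
have c1 : d <= clamp (d / 2 * N%:R) by rewrite /clamp le_max le_min d_le1 ddN orbT.
by rewrite lerXn2r ?nnegrE ?(ltW d0) // (le_trans (ltW d0)).
Qed.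

Lemma linweight_gap_le_rho : exists2 C, 0 < C & gap_bound C.
Proof.
have [|] := ltP alpha 1; first exact: linweight_gap_le_rho_lt1.
rewrite le_eqVlt => /predU1P[/esym|].
  exact: linweight_gap_le_rho_eq1.
exact: linweight_gap_le_rho_gt1.
Qed.

Lemma linweight_gap_ge_rho : exists2 c, 0 < c &
  forall (N : nat) (d1 d2 : R), (2 <= N)%N -> `|d1| <= D -> `|d2| <= D ->
    c * rho alpha N <= spectral_gap (metropolis (linweight (N := N) d1 d2 alpha)).
Proof.
have [C C0 CP] := power_sum_rho alpha0.
have K0 : 0 < 128 * (2 * (D + 3)) `^ alpha * C.
  by have D0 := lt_le_trans ltr01 D1; positive.
exists (128 * (2 * (D + 3)) `^ alpha * C)^-1; first by rewrite invr_gt0.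
move=> N d1 d2 N2 d1D d2D; have N0 := ltnW N2.
have D0 : 0 <= D := le_trans ler01 D1.
apply: le_trans (linweight_gap_ge d1D d2D N0 alpha0 D0).
have r0 := rho_gt0 alpha N2.
have N20 : (0 < N.*2)%N by rewrite double_gt0.
have p0 : 0 < power_sum N.*2 alpha := lt_le_trans ltr01 (power_sum_ge1 alpha N20).
rewrite -[rho alpha N]invrK -invfM lef_pV2 ?posrE; last first.
- by have Dp := lt_le_trans ltr01 D1; positive; rewrite ltr0n.
- by positive.

have e : N.*2%:R = 2 * N%:R :> R by rewrite -mul2n natrM.
have -> : 64 * N.*2%:R * ((D + 3) * N.*2%:R) `^ alpha * power_sum N.*2 alpha =
    128 * (2 * (D + 3)) `^ alpha * (N%:R * N%:R `^ alpha * power_sum N.*2 alpha).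
  rewrite e [(D + 3) * _]mulrA [(D + 3) * 2]mulrC (@powRM _ (2 * (D + 3))) //.
    by ring.
  by rewrite mulr_ge0 // addr_ge0.
by rewrite -[leRHS]mulrA ler_wpM2l ?CP // mulr_ge0 ?powR_ge0.
Qed.

End UpperBound.

(** * Distance to a line *)

(** The vector [u] is a unit normal of the line. *)
Lemma dist_line (R : realType) (L : set (R * R)) : line_through_origin L ->
  exists u : R * R, u.1 ^+ 2 + u.2 ^+ 2 = 1 /\
    forall x, d2 x L = `|u.1 * x.1 + u.2 * x.2|.
Proof.
move=> [[v1 v2] v0 ->]; pose q := v1 ^+ 2 + v2 ^+ 2; pose r := Num.sqrt q.
have q0 : 0 < q.
  rewrite lt_def addr_ge0 ?sqr_ge0 // andbT paddr_eq0 ?sqr_ge0 // !sqrf_eq0.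
  by apply: contra v0 => /andP[/eqP -> /eqP ->].
have r0 : 0 < r by rewrite sqrtr_gt0.
have rq : r ^+ 2 = q by rewrite sqr_sqrtr // ltW.
have rn : r != 0 by rewrite gt_eqF.
exists (v2 / r, - v1 / r); split => [|[x1 x2]] /=.
  rewrite !expr_div_n sqrrN -mulrDl rq -[v2 ^+ 2 + _]addrC -/q divff //.
  by rewrite gt_eqF.
set m := v2 / r * x1 + - v1 / r * x2.
have m2 : m ^+ 2 * q = (v2 * x1 - v1 * x2) ^+ 2.
  by rewrite -rq /m; field.
apply/le_anti/andP; split.
  apply: ge_inf.
    by exists 0 => _ [y _ <-]; exact: sqrtr_ge0.
  (* The infimum is attained at the orthogonal projection. *)
  pose t := (v1 * x1 + v2 * x2) / q.
  exists (t * v1, t * v2); first by exists t.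
  rewrite /euclid_dist /= -sqrtr_sqr; congr Num.sqrt.
  apply: (mulIf (lt0r_neq0 q0)); rewrite m2 /t /q; field.
  by rewrite -/q gt_eqF.
apply: lb_le_inf.
  by exists (euclid_dist (x1, x2) (0 * v1, 0 * v2)); exists (0 * v1, 0 * v2) => //; exists 0.
move=> _ [_ [t _ <-] <-]; rewrite /euclid_dist /= -sqrtr_sqr ler_sqrt ?addr_ge0 ?sqr_ge0 //.
rewrite -(ler_pM2r q0) m2 -subr_ge0.
(* Lagrange identity for v and x - t v, whose determinant does not depend on t. *)
have -> : ((x1 - t * v1) ^+ 2 + (x2 - t * v2) ^+ 2) * q - (v2 * x1 - v1 * x2) ^+ 2 =
  (v1 * (x1 - t * v1) + v2 * (x2 - t * v2)) ^+ 2 by rewrite /q; ring.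
exact: sqr_ge0.
Qed.

Lemma metropolis_scale (R : realType) (N : nat) (Z : R) (w : grid N -> R) :
  Z != 0 -> metropolis (fun k => Z * w k) = metropolis w.
Proof.
move=> Z0; have e k l : metropolis_move (fun k => Z * w k) k l = metropolis_move w k l.
  by rewrite /metropolis_move -mulf_div divff // mul1r.
apply/funext => k; apply/funext => l; rewrite /metropolis e.
by under eq_bigr do rewrite e.
Qed.

(** The slopes are A/N times a unit normal of [L]. The normalizing constant disappears because the
    chain only sees ratios of weights. *)
Lemma metropolis_pi_N (R : realType) (alpha A : R) (L : set (R * R)) (N : nat) :
  0 < A -> (0 < N)%N -> line_through_origin L ->
  exists d1 d2 : R, d1 ^+ 2 + d2 ^+ 2 = (A / N%:R) ^+ 2 /\
    metropolis (pi_N alpha A L (N := N)) = metropolis (linweight d1 d2 alpha).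
Proof.
move=> A0 N0 /dist_line[[u1 u2] /= [u12 dL]].
have Np : 0 < N%:R :> R by rewrite ltr0n.
exists (A / N%:R * u1), (A / N%:R * u2); split.
  by rewrite !exprMn -mulrDr u12 mulr1.
have FE : F_N alpha A L (N := N) = linweight (A / N%:R * u1) (A / N%:R * u2) alpha.
  apply/funext => k; rewrite /F_N /linweight dL; congr ((1 + _) `^ _).
  rewrite -[A in LHS]gtr0_norm // -normrM; congr `|_|.
  rewrite /lin /pos /grid_point /Defs.coord /= !(rmorphD, rmorphB, rmorph1) /=.
  by field; rewrite gt_eqF.
rewrite -(@metropolis_scale _ _ (Z_N alpha A L N) (linweight _ _ _)) -?FE //.
have N20 : (0 < N.*2)%N by rewrite double_gt0.
rewrite invr_eq0 FE gt_eqF // (bigD1 (Ordinal N20, Ordinal N20)) //=.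
rewrite ltr_pwDl ?linweight_gt0 // sumr_ge0 // => k _.
by rewrite ltW // linweight_gt0.
Qed.

(** * Two-sided bound for the target measure *)

Unset Implicit Arguments.

Theorem proposition4p1 (R : realType) (eps alpha : R)
    (heps0 : 0 < eps) (heps1 : eps < 1) (halpha : 0 < alpha) :
  exists c C : R,
    [/\ 0 < c, c <= C &
      forall (L : set (R * R)) (A : R) (N : nat),
        line_through_origin L -> 0 < A -> (2 <= N)%N ->
        eps * A <= N%:R <= A / eps ->
        c * rho alpha N <= spectral_gap (metropolis (pi_N alpha A L (N := N)))
          <= C * rho alpha N].
Proof.
(* The slope vector has length A/N in [eps, 1/eps], hence the choices D = 1/eps and d = eps/2. *)
have D1 : 1 <= eps^-1 by rewrite invf_ge1 // ltW.
have d01 : 0 < eps / 2 <= 1 by apply/andP; split; lra.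
have [c c0 cP] := linweight_gap_ge_rho halpha D1.
have [C C0 CP] := linweight_gap_le_rho halpha D1 d01.
exists c, (Num.max c C); split=> //; first by rewrite le_max lexx.
move=> L A N hL A0 N2 /andP[NA AN]; have N0 := ltnW N2.
have Np : 0 < N%:R :> R by rewrite ltr0n.
have [d1 [d2 [d12 ->]]] := metropolis_pi_N alpha A0 N0 hL.
have a_le : A / N%:R <= eps^-1.
  by rewrite ler_pdivrMr // mulrC -ler_pdivrMr ?invr_gt0 // invrK mulrC.
have a_ge : eps <= A / N%:R by rewrite ler_pdivlMr // mulrC -ler_pdivlMr.
move: (A / N%:R) a_le a_ge d12 => a a_le a_ge d12.
have a0 : 0 < a := lt_le_trans heps0 a_ge.
have le_a (x y : R) : x ^+ 2 + y ^+ 2 = a ^+ 2 -> `|x| <= eps^-1.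
  move=> xy; apply: le_trans a_le.
  rewrite -(ler_pXn2r (ltn0Sn 1)) ?nnegrE ?(ltW a0) // real_normK ?num_real //.
  by rewrite -xy lerDl sqr_ge0.
(* If both slopes were below eps/2, their squares would add up to less than eps^2/2, although the
   sum is at least eps^2. *)
have dd : eps / 2 <= `|d1| \/ eps / 2 <= `|d2|.
  have [h1|h1] := leP (eps / 2) `|d1|; [by left|right].
  rewrite leNgt; apply/negP => h2.
  have := d12; rewrite -(real_normK (num_real d1)) -(real_normK (num_real d2)).
  have := normr_ge0 d1; have := normr_ge0 d2.
  move: `|d1| `|d2| h1 h2 => x y *; nra.
have d1D := le_a _ _ d12; have d2D : `|d2| <= eps^-1 by apply: (le_a _ d1); rewrite addrC.
rewrite cP //=; apply: le_trans (CP _ _ _ N2 d1D d2D dd) _.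
by rewrite ler_wpM2r ?(ltW (rho_gt0 _ N2)) // le_max lexx orbT.
Qed.
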